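(* Define the formal power series $$\chi(y,\kappa):=y+\sum_{n=3}^{\infty}n\,\kappa\,y^{n-1}\,\widetilde\chi_{0,n}(\kappa),\qquad \psi(y,\kappa):=\sum_{n=1}^\infty n\,\kappa\,y^{n-1}\,\widetilde\chi_{1,n}(\kappa).$$ Then $$(1+y-\kappa\chi)\,\psi=\frac12\kappa^2\chi'-\frac1{12}\kappa,\qquad \chi'=\frac{\partial\chi}{\partial y}.$$
   Context: Stable graphs: a stable graph is a finite graph (loops and multiple edges allowed) with internal edges, each joining two (possibly equal) vertices, and unlabelled external edges, each attached to one vertex. Each vertex $v$ carries a genus $g_v\in\mathbb Z_{\ge0}$; its valence $\mathrm{val}_v$ is the number of half-edges at $v$ (an external edge counts once, a loop twice); stability means $2g_v-2+\mathrm{val}_v>0$ for every $v$. The genus of a connected stable graph $\Gamma$ is $h^1(\Gamma)+\sum_v g_v$. $\mathcal G^c_{g,n}$ is the (finite) set of isomorphism classes of connected stable graphs of genus $g$ with $n$ external edges, $V(\Gamma)$ and $E(\Gamma)$ are the sets of vertices and internal edges, and $\mathrm{Aut}(\Gamma)$ is the automorphism group (acting on vertices and half-edges; external edges may be permuted). For $2g-2+n>0$, $\chi(\mathcal M_{g,n})$ is the orbifold Euler characteristic of the moduli space of smooth genus $g$ curves with $n$ marked points, given by the Harer–Zagier formula $\chi(\mathcal M_{g,n})=(-1)^n\frac{(2g-1)B_{2g}}{(2g)!}(2g+n-3)!$. The refined orbifold Euler characteristic (at $t=1$) is the polynomial $$\widetilde\chi_{g,n}(\kappa):=\sum_{\Gamma\in\mathcal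 G^c_{g,n}}\frac{\kappa^{|E(\Gamma)|}}{|\mathrm{Aut}(\Gamma)|}\prod_{v\in V(\Gamma)}\chi(\mathcal M_{g_v,\mathrm{val}_v}).$$ *)

(* Defs.v *)
From HB Require Import structures.
From mathcomp Require Import all_boot all_order all_algebra.
From mathcomp Require Import generic_quotient zify.
From mathcomp Require Import boolp classical_sets functions cardinality fsbigop.

Set Implicit Arguments.
Unset Strict Implicit.
Unset Printing Implicit Defensive.

Import Order.TTheory GRing.Theory Num.Theory.

Local Open Scope ring_scope.
Local Open Scope quotient_scope.

(* [fps R] is R[[y]], a series being given by its coefficients; powers of y   *)
(* multiply as in the Cauchy product.                                         *)

Record fps (R : Type) : Type := Fps { fcoef : nat -> R }.

Lemma fpsP (R : Type) (f g : fps R) : fcoef f =1 fcoef g -> f = g.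
Proof. by case: f g => [f] [g] /= /funext ->. Qed.

HB.instance Definition _ (R : Type) := gen_eqMixin (fps R).
HB.instance Definition _ (R : Type) := gen_choiceMixin (fps R).

Section FpsRing.
Variable R : comNzRingType.
Implicit Types f g h : fps R.

Definition fps_add f g := Fps (fun k => fcoef f k + fcoef g k).
Definition fps_opp f := Fps (fun k => - fcoef f k).
Definition fps_mul f g :=
  Fps (fun k => \sum_(i < k.+1) fcoef f i * fcoef g (k - i)).
Definition fpsC (c : R) : fps R := Fps (fun k => if k == 0%N then c else 0).
Definition fpsX : fps R := Fps (fun k => (k == 1%N)%:R).
Definition fps_deriv f : fps R := Fps (fun k => fcoef f k.+1 *+ k.+1).

Lemma fps_addA : associative fps_add.
Proof. by move=> f g h; apply: fpsP => k /=; rewrite addrA. Qed.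
Lemma fps_addC : commutative fps_add.
Proof. by move=> f g; apply: fpsP => k /=; rewrite addrC. Qed.
Lemma fps_add0 : left_id (fpsC 0) fps_add.
Proof. by move=> f; apply: fpsP => k /=; rewrite if_same add0r. Qed.
Lemma fps_addN : left_inverse (fpsC 0) fps_opp fps_add.
Proof. by move=> f; apply: fpsP => k /=; rewrite if_same addNr. Qed.

HB.instance Definition _ :=
  GRing.isZmodule.Build (fps R) fps_addA fps_addC fps_add0 fps_addN.

Definition fps_trunc m f : {poly R} := \poly_(i < m) fcoef f i.

Lemma fcoef_mul_trunc m f g k : (k < m)%N ->
  fcoef (fps_mul f g) k = (fps_trunc m f * fps_trunc m g)`_k.
Proof.
move=> km; rewrite coefM; apply: eq_bigr => i _; rewrite !coef_poly.
by rewrite !(leq_ltn_trans _ km) ?leq_subr// -ltnS.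
Qed.

Lemma fps_mulC : commutative fps_mul.
Proof.
by move=> f g; apply: fpsP => k; rewrite !(@fcoef_mul_trunc k.+1)// mulrC.
Qed.

Lemma fps_mulA : associative fps_mul.
Proof.
move=> f g h; apply: fpsP => k; rewrite !(@fcoef_mul_trunc k.+1)//.
transitivity ((fps_trunc k.+1 f * fps_trunc k.+1 g * fps_trunc k.+1 h)`_k).
  rewrite -mulrA [LHS]coefM [RHS]coefM; apply: eq_bigr => i _; congr (_ * _).
  have lk : (k - i < k.+1)%N by rewrite ltnS leq_subr.
  by rewrite [LHS]coef_poly lk (@fcoef_mul_trunc k.+1).
rewrite [LHS]coefM [RHS]coefM; apply: eq_bigr => i _; congr (_ * _).
by rewrite [RHS]coef_poly ltn_ord (@fcoef_mul_trunc k.+1).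
Qed.

Lemma fps_mul1 : left_id (fpsC 1) fps_mul.
Proof.
move=> f; apply: fpsP => k /=; rewrite big_ord_recl /= mul1r subn0.
by rewrite big1 ?addr0// => i _; rewrite mul0r.
Qed.

Lemma fps_mulDl : left_distributive fps_mul fps_add.
Proof.
move=> f g h; apply: fpsP => k /=; rewrite -big_split /=.
by apply: eq_bigr => i _; rewrite mulrDl.
Qed.

Lemma fps_1neq0 : fpsC 1 != fpsC 0.
Proof.
by apply/eqP => /(congr1 (fun f => fcoef f 0%N)) /eqP; rewrite (oner_eq0 R).
Qed.

HB.instance Definition _ := GRing.Zmodule_isComNzRing.Build (fps R)
  fps_mulA fps_mulC fps_mul1 fps_mulDl fps_1neq0.

End FpsRing.

(* A graph is given by its half-edges: [root h] is the vertex carrying [h],   *)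
(* and the involution [flip] exchanges the two halves of an internal edge and *)
(* fixes the external edges.  Up to isomorphism the vertices and half-edges   *)
(* may be taken in 'I_nv and 'I_nh.                                           *)

Record graph : Type := Graph {
  nv : nat;
  nh : nat;
  root : {ffun 'I_nh -> 'I_nv};
  flip : {ffun 'I_nh -> 'I_nh};
  gen : {ffun 'I_nv -> nat};
  flip_inv : [forall h, flip (flip h) == h] }.

Definition graph_data (s : nat * nat) : Type :=
  ({ffun 'I_s.2 -> 'I_s.1} * {ffun 'I_s.2 -> 'I_s.2}
   * {ffun 'I_s.1 -> nat})%type.

Definition encode_graph (G : graph) : {s : nat * nat & graph_data s} :=
  existT graph_data (nv G, nh G) (root G, flip G, gen G).

Definition decode_graph (c : {s : nat * nat & graph_data s}) : option graph :=
  let: existT s d := c in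
  if @idP [forall h, d.1.2 (d.1.2 h) == h] is ReflectT flipK then
    Some (@Graph s.1 s.2 d.1.1 d.1.2 d.2 flipK) else None.

Lemma encode_graphK : pcancel encode_graph decode_graph.
Proof.
case=> p q r f g fP; rewrite /decode_graph /=; case: {-}_ / idP => // fP'.
by rewrite (bool_irrelevance fP fP').
Qed.

HB.instance Definition _ (s : nat * nat) := Choice.on (graph_data s).
HB.instance Definition _ := Choice.copy graph (pcan_type encode_graphK).

Section Graph.
Variable G : graph.

Definition legs : {set 'I_(nh G)} := [set h | flip G h == h].

Definition edges : {set {set 'I_(nh G)}} :=
  [set [set h; flip G h] | h in ~: legs].

Definition valence (v : 'I_(nv G)) : nat := #|[set h | root G h == v]|.

Definition adjacent : rel 'I_(nv G) := fun u v =>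
  [exists h, (root G h == u) && (root G (flip G h) == v)].

Definition num_components : nat := n_comp adjacent predT.

Definition connected_graph : bool := num_components == 1%N.

Definition stable_graph : bool :=
  [forall v, (2 < 2 * gen G v + valence v)%N].

(* The first Betti number, by the Euler-Poincare formula. *)
Definition h1 : int := #|edges|%:Z - (nv G)%:Z + num_components%:Z.

Definition genus : int := h1 + (\sum_v gen G v)%N%:Z.

End Graph.

Definition bijectiveb (A B : finType) (f : {ffun A -> B}) : bool :=
  injectiveb f && [forall b, b \in codom f].

Definition graph_map (G1 G2 : graph) : Type :=
  ({ffun 'I_(nv G1) -> 'I_(nv G2)} * {ffun 'I_(nh G1) -> 'I_(nh G2)})%type.
HB.instance Definition _ G1 G2 := Finite.on (graph_map G1 G2).

Definition is_iso (G1 G2 : graph) (f : graph_map G1 G2) : bool :=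
  [&& bijectiveb f.1, bijectiveb f.2,
      [forall h, root G2 (f.2 h) == f.1 (root G1 h)],
      [forall h, flip G2 (f.2 h) == f.2 (flip G1 h)]
    & [forall v, gen G2 (f.1 v) == gen G1 v]].

Definition isomorphic (G1 G2 : graph) : bool :=
  [exists f : graph_map G1 G2, is_iso f].

Definition graph_Aut (G : graph) : {set graph_map G G} := [set f | is_iso f].

Lemma bijectivebP (A B : finType) (f : {ffun A -> B}) :
  reflect (bijective f) (bijectiveb f).
Proof.
apply: (iffP andP) => [[/injectiveP fi /forallP fs]|fb].
  by exists (fun b => iinv (fs b)) => x; [apply: fi|]; rewrite f_iinv.
split; first exact/injectiveP/bij_inj.
by case: fb => g _ gK; apply/forallP => b; rewrite -(gK b) codom_f.
Qed.

Lemma isomorphic_refl : reflexive isomorphic.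
Proof.
move=> G; apply/existsP; exists ([ffun v => v], [ffun h => h]).
apply/and5P; split; [apply/bijectivebP|apply/bijectivebP|..];
  try by (exists id => x; rewrite ffunE).
- by apply/forallP => h; rewrite !ffunE.
- by apply/forallP => h; rewrite !ffunE.
- by apply/forallP => h; rewrite !ffunE.
Qed.

Lemma isomorphic_trans : transitive isomorphic.
Proof.
move=> G2 G1 G3 /existsP[f /and5P[/bijectivebP f1 /bijectivebP f2
  /forallP fr /forallP ff /forallP fg]].
move=> /existsP[k /and5P[/bijectivebP k1 /bijectivebP k2
  /forallP kr /forallP kf /forallP kg]].
apply/existsP; exists ([ffun v => k.1 (f.1 v)], [ffun h => k.2 (f.2 h)]).
apply/and5P; split; [apply/bijectivebP|apply/bijectivebP|..].
- by apply: (eq_bij (bij_comp k1 f1)) => v; rewrite ffunE.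
- by apply: (eq_bij (bij_comp k2 f2)) => h; rewrite ffunE.
- by apply/forallP => h; rewrite !ffunE (eqP (kr _)) (eqP (fr _)).
- by apply/forallP => h; rewrite !ffunE (eqP (kf _)) (eqP (ff _)).
- by apply/forallP => v; rewrite !ffunE (eqP (kg _)) (eqP (fg _)).
Qed.

Lemma isomorphic_sym : symmetric isomorphic.
Proof.
suff sym G1 G2 : isomorphic G1 G2 -> isomorphic G2 G1.
  by move=> G1 G2; apply/idP/idP; apply: sym.
move=> /existsP[[a b] /and5P[/bijectivebP/= [a' aK a'K] /bijectivebP/= [b' bK b'K]
  /forallP fr /forallP ff /forallP fg]].
apply/existsP; exists ([ffun v => a' v], [ffun h => b' h]).
apply/and5P; split; [apply/bijectivebP|apply/bijectivebP|..] => /=.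
- by exists a => v; rewrite ffunE.
- by exists b => v; rewrite ffunE.
- apply/forallP => h; rewrite !ffunE; move: (eqP (fr (b' h))) => /=.
  by rewrite b'K => ->; rewrite aK.
- apply/forallP => h; rewrite !ffunE; move: (eqP (ff (b' h))) => /=.
  by rewrite b'K => ->; rewrite bK.
- apply/forallP => v; rewrite !ffunE; move: (eqP (fg (a' v))) => /=.
  by rewrite a'K => ->.
Qed.

Canonical isomorphic_equiv :=
  EquivRel isomorphic isomorphic_refl isomorphic_sym isomorphic_trans.

Definition iso_class : Type := {eq_quot isomorphic}.
HB.instance Definition _ := Choice.on iso_class.
HB.instance Definition _ := EqQuotient.on iso_class.

(* The membership conditions, and the summand of [chi_tilde] below, are       *)
(* isomorphism invariant, so that any representative of the class would do.   *)
Definition Gc (g n : nat) : set iso_class :=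
  [set C | let G := repr C in
    [/\ connected_graph G, stable_graph G, genus G = g%:Z
      & #|legs G| = n]]%classic.

Lemma sum_valence (G : graph) : (\sum_(v : 'I_(nv G)) valence v = nh G)%N.
Proof.
rewrite -[RHS]card_ord -sum1_card (partition_big (root G) predT)//=.
by apply: eq_bigr => v _; rewrite sum1dep_card.
Qed.

Lemma nh_le (G : graph) : (nh G <= 2 * #|edges G| + #|legs G|)%N.
Proof.
rewrite -[X in (X <= _)%N]card_ord -(cardC (mem (legs G))) addnC leq_add2r.
have -> : #|[predC mem (legs G)]| = #|~: legs G| by apply: eq_card => h; rewrite !inE.
have sub : ~: legs G \subset finset.cover (edges G).
  apply/fintype.subsetP => h hG; apply/bigcupP; exists [set h; flip G h].
    exact: imset_f.
  by rewrite !inE eqxx.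
apply: (leq_trans (subset_leq_card sub)).
apply: (leq_trans (leq_card_cover _).1); rewrite mulnC -sum_nat_const.
by apply: leq_sum => e /imsetP[h _ ->]; rewrite cards2; case: (_ != _).
Qed.

(* [\sum_(C \in A) F C] is 0 by convention when infinitely many summands are  *)
(* nonzero, which the following lemma excludes for [A = Gc g n].              *)
Lemma finite_Gc (g n : nat) : finite_set (Gc g n).
Proof.
pose N := (2 * g + n).+1; pose M := (3 * (2 * g + n)).+1.
pose D := {s : 'I_N * 'I_M &
  ({ffun 'I_(s.2) -> 'I_(s.1)} * {ffun 'I_(s.2) -> 'I_(s.2)}
   * {ffun 'I_(s.1) -> 'I_M})%type}.
pose dec (d : D) : option iso_class :=
  omap \pi_iso_class (decode_graph
    (let: existT s x := d in
     existT graph_data (val s.1, val s.2) (x.1, [ffun i => val (x.2 i)]))).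
have fin : finite_set (range (fun d => odflt (\pi_iso_class
    (@Graph 0 0 [ffun h => h] [ffun h => h] [ffun v => 0%N]
      ltac:(by apply/forallP => h; rewrite !ffunE))) (dec d))).
  exact/finite_image/finite_finset.
apply: sub_finite_set fin => C; rewrite /Gc /=.
set G := repr C => -[/eqP cG /forallP sG gG lG].
have sumE : ((nv G) + 2 * nv G <= 2 * \sum_v gen G v + nh G)%N.
  rewrite -(sum_valence G) big_distrr /= -big_split /=.
  rewrite -mulSn mulnC -[X in (X * _)%N]card_ord -sum_nat_const.
  by apply: leq_sum => v _; apply: sG.
have := nh_le G; rewrite lG => nhG.
move: gG; rewrite /genus /h1 cG => gG.
have ltN : (nv G < N)%N by rewrite /N; lia.
have ltM : (nh G < M)%N by rewrite /M; lia.
have ltg v : (gen G v < M)%N.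
  have : (gen G v <= \sum_v gen G v)%N by rewrite (bigD1 v)//= leq_addr.
  rewrite /M; lia.
exists (existT (fun s : 'I_N * 'I_M =>
  ({ffun 'I_(s.2) -> 'I_(s.1)} * {ffun 'I_(s.2) -> 'I_(s.2)}
   * {ffun 'I_(s.1) -> 'I_M})%type) (Ordinal ltN, Ordinal ltM)
  (root G, flip G, [ffun v => Ordinal (ltg v)])) => //.
rewrite /dec.
have -> : [ffun i => val ([ffun v => Ordinal (ltg v)] i)] = gen G.
  by apply/ffunP => v; rewrite !ffunE.
by have := encode_graphK G; rewrite /encode_graph /= => -> /=; rewrite reprK.
Qed.

(* [bernoulli_seq m] is [:: B_0; ...; B_m.-1].  The convention is B_1 = -1/2, *)
(* which is irrelevant here as only even indices are used.                    *)
Fixpoint bernoulli_seq (m : nat) : seq rat :=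
  if m is m'.+1 then
    let s := bernoulli_seq m' in
    rcons s (((m' == 0%N)%:R - \sum_(k < m') 'C(m, k)%:R * s`_k) / m%:R)
  else [::].

Definition bernoulli (m : nat) : rat := (bernoulli_seq m.+1)`_m.

Lemma size_bernoulli_seq m : size (bernoulli_seq m) = m.
Proof. by elim: m => //= m IH; rewrite size_rcons IH. Qed.

Lemma nth_bernoulli_seq m k : (k < m)%N -> (bernoulli_seq m)`_k = bernoulli k.
Proof.
elim: m => // m IH; rewrite ltnS leq_eqVlt => /orP[/eqP-> //|km].
by rewrite /= nth_rcons size_bernoulli_seq km IH.
Qed.

Lemma bernoulliE m :
  \sum_(k < m.+1) 'C(m.+1, k)%:R * bernoulli k = (m == 0%N)%:R.
Proof.
rewrite big_ord_recr /= binSn {2}/bernoulli /= nth_rcons size_bernoulli_seq.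
rewrite ltnn eqxx mulrCA mulfV ?pnatr_eq0// mulr1.
rewrite (eq_bigr (fun k : 'I_m => 'C(m.+1, k)%:R * (bernoulli_seq m)`_k)).
  by rewrite addrC subrK.
by move=> k _; rewrite nth_bernoulli_seq.
Qed.

(* The Harer-Zagier formula, meaningful for 2g - 2 + n > 0; the truncated     *)
(* subtraction is then exact.                                                 *)
Definition chi_M (g n : nat) : rat :=
  (-1) ^+ n * ((2 * g%:R - 1) * bernoulli (2 * g) / ((2 * g)`!)%:R)
  * ((2 * g + n - 3)`!)%:R.

Definition chi_tilde (g n : nat) : {poly rat} :=
  \sum_(C \in Gc g n)
    let G := repr C in
    ((#|graph_Aut G|%:R)^-1 * \prod_v chi_M (gen G v) (valence v))
      *: 'X^#|edges G|.

(* Power series in y over rat[kappa], with kappa the variable of {poly rat}.  *)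

Definition kappa : fps {poly rat} := fpsC 'X.

Definition ratC (c : rat) : fps {poly rat} := fpsC c%:P.

(* In the sums below, k = n - 1 is the exponent of y. *)

Definition chi : fps {poly rat} :=
  fpsX _ +
  Fps (fun k => if (3 <= k.+1)%N then 'X * chi_tilde 0 k.+1 *+ k.+1 else 0).

Definition psi : fps {poly rat} :=
  Fps (fun k => 'X * chi_tilde 1 k.+1 *+ k.+1).

(* Main.v *)
Require Import Defs.
From HB Require Import structures.
From mathcomp Require Import all_boot all_order all_algebra.
From mathcomp Require Import perm generic_quotient zify ring lra.
From mathcomp Require finmap cardinality fsbigop.

Set Implicit Arguments.
Unset Strict Implicit.
Unset Printing Implicit Defensive.

Import Order.TTheory GRing.Theory Num.Theory.

Local Open Scope ring_scope.

(** Write F_g = sum_n chi_tilde g n * y^n, primes being derivatives in y.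
    Choosing an edge of a connected graph and cutting it into two legs leaves
    either a connected graph of genus g - 1 or two connected graphs whose genera
    add up to g, so that

      2 * dF_g/dkappa = F_(g-1)'' + sum_(a + b = g) F_a' * F_b',

    while at kappa = 0 only the graphs with one vertex remain and the
    coefficient of y^n in F_g is chi(M_(g,n)) / n!.  These equations determine
    F_0 and F_1.

    To count with the weight 1/|Aut|, vertices and half-edges are labelled: a
    class of graphs with p vertices and q half-edges has p! q! / |Aut|
    labellings ([card_labellings]).  On labelled graphs, cutting the edge
    {h, h'} keeps the vertices and the half-edges and only composes the
    involution with the transposition of h and h' ([toggle]); it is its own
    inverse, which makes the count of [cut_recursion] a reindexing.  Graphs with
    two components are counted by the sets of vertices and of half-edges of the
    first component ([split_sum]).  Genera are recorded by a formal variable z: a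
    vertex with n half-edges has the weight sum_g z^g chi(M_(g,n)), and a
    connected graph with p vertices and k edges gets the further factor
    z^(k + 1 - p) from its first Betti number ([genus_poly]).

    Put u = F_0' and r = F_1', so that chi = y + kappa u and psi = kappa r, and
    D = d/dkappa - u d/dy.  The equations for g = 0, 1 give D u = 0 and
    D r = u''/2 + u' r; in particular D chi = 0.  With A = 1 + y - kappa chi, the
    series Q = A u' - u - chi satisfies D Q = u' Q and vanishes at kappa = 0,
    because F_0 then is sum_n (-1)^(n-1) y^n / (n (n-1) (n-2)); hence Q = 0.
    The series E = A r - kappa chi' / 2 + 1/12 satisfies D E = r Q + Q'/2 = 0
    and vanishes at kappa = 0, where r = - 1 / (12 (1 + y)); hence E = 0, and
    kappa E = 0 is the assertion. *)

(** * Graphs as permutations of half-edges *)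

(** The pair of the map attaching each half-edge to a vertex and of the map
    exchanging the two halves of each edge; the latter is required to be an
    involution ([flipK]) only where this matters, so that sums over graphs are
    sums over a plain finite type. *)
Definition hgraph (V H : finType) : Type :=
  ({ffun H -> V} * {ffun H -> H})%type.
HB.instance Definition _ V H := Finite.on (hgraph V H).

Section HGraph.
Variables V H : finType.
Implicit Types (x : hgraph V H) (S : {set V}) (h : H).

Definition flipK x := [forall h, x.2 (x.2 h) == h].
Definition hlegs x : {set H} := [set h | x.2 h == h].
Definition hvalence x (v : V) : nat := #|[set h | x.1 h == v]|.
(** The unions of connected components, described without paths. *)
Definition hclosed x S := [forall h, (x.1 h \in S) == (x.1 (x.2 h) \in S)].
Definition hcomponent x S :=
  [&& S != set0, hclosed x S &
   [forall S' : {set V}, hclosed x S' && (S' \subset S) ==> (S' == set0) || (S' == S)]].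
Definition hconn x := hcomponent x setT.

Lemma flipKP x : reflect (involutive x.2) (flipK x).
Proof. by apply: (iffP forallP) => fK h; apply/eqP; apply: fK. Qed.

Lemma hclosedP x S :
  reflect (forall h, (x.1 h \in S) = (x.1 (x.2 h) \in S)) (hclosed x S).
Proof. by apply: (iffP forallP) => cS h; apply/eqP; apply: cS. Qed.

Lemma hclosedC x S : hclosed x S -> hclosed x (~: S).
Proof. by move/hclosedP=> cS; apply/hclosedP => h; rewrite !inE cS. Qed.

Lemma hclosedI x S1 S2 : hclosed x S1 -> hclosed x S2 -> hclosed x (S1 :&: S2).
Proof. by move=> /hclosedP c1 /hclosedP c2; apply/hclosedP => h; rewrite !inE c1 c2. Qed.

Lemma hclosedT x : hclosed x setT.
Proof. by apply/hclosedP => h; rewrite !inE. Qed.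

Lemma hcomponentP x S : reflect
  [/\ S != set0, hclosed x S & forall S', hclosed x S' -> S' \subset S -> S' = set0 \/ S' = S]
  (hcomponent x S).
Proof.
apply: (iffP and3P) => -[S0 cS SS]; split=> //.
  move=> S' cS' sS; move/forallP/(_ S'): SS; rewrite cS' sS /=.
  by case/orP=> /eqP->; [left|right].
apply/forallP => S'; apply/implyP => /andP[cS' sS].
by case: (SS S' cS' sS) => ->; rewrite eqxx ?orbT.
Qed.

Lemma hconnP x : reflect
  ([set: V] != set0 /\ forall S, hclosed x S -> S = set0 \/ S = setT) (hconn x).
Proof.
apply: (iffP (hcomponentP _ _)) => [[V0 _ cS]|[V0 cS]]; split=> //.
- by move=> S cS'; apply: cS => //; apply: subsetT.
- exact: hclosedT.
- by move=> S cS' _; apply: cS.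
Qed.

(** An intersection of closed sets is closed, and a component is minimal. *)
Lemma hcomponentI x S S' : hcomponent x S -> hclosed x S' ->
  [disjoint S & S'] \/ S \subset S'.
Proof.
move=> /hcomponentP[_ cS SS] cS'.
case: (SS (S :&: S') (hclosedI cS cS') (subsetIl _ _)) => [I0|IS].
  by left; rewrite -setI_eq0 I0.
by right; apply/setIidPl.
Qed.

(** Cuts the edge {h, h'} if there is one, and glues h to h' if both are legs. *)
Definition toggle (h h' : H) x : hgraph V H := (x.1, [ffun z => x.2 (tperm h h' z)]).

Lemma toggleK h h' : involutive (toggle h h').
Proof.
case=> r f; rewrite /toggle /=; congr (_, _); apply/ffunP => z.
by rewrite !ffunE tpermK.
Qed.

Lemma flipK_toggle h h' x : flipK x -> x.2 h = h -> x.2 h' = h' -> flipK (toggle h h' x).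
Proof.
move=> /flipKP fK xh xh'; apply/flipKP => z /=; rewrite !ffunE.
case: (tpermP h h' z) => [->|->|/eqP zh /eqP zh']; rewrite ?xh ?xh' ?tpermL ?tpermR ?xh ?xh' //.
rewrite tpermD ?fK // eq_sym.
  by apply: contraNneq zh => zE; rewrite -[z]fK zE xh.
by apply: contraNneq zh' => zE; rewrite -[z]fK zE xh'.
Qed.

Lemma flipK_toggleV h h' x : flipK x -> x.2 h = h' -> flipK (toggle h h' x).
Proof.
move=> /flipKP fK xh; have xh' : x.2 h' = h by rewrite -xh fK.
apply/flipKP => z /=; rewrite !ffunE.
case: (tpermP h h' z) => [->|->|/eqP zh /eqP zh']; rewrite ?xh ?xh' ?tpermL ?tpermR ?xh ?xh' //.
rewrite tpermD ?fK // eq_sym.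
  by apply: contraNneq zh' => zE; rewrite -[z]fK zE xh.
by apply: contraNneq zh => zE; rewrite -[z]fK zE xh'.
Qed.

Lemma hlegs_toggle h h' x : h != h' -> x.2 h = h -> x.2 h' = h' ->
  hlegs x = h |: (h' |: hlegs (toggle h h' x)).
Proof.
move=> hh' xh xh'; apply/setP => z; rewrite !inE ffunE.
case: tpermP => [->|->|/eqP/negPf-> /eqP/negPf->]; rewrite ?xh ?xh' ?eqxx ?orbT //.
Qed.

Lemma card_hlegs_toggle h h' x : h != h' -> x.2 h = h -> x.2 h' = h' ->
  #|hlegs x| = (#|hlegs (toggle h h' x)|.+2)%N.
Proof.
move=> hh' xh xh'; rewrite (hlegs_toggle hh' xh xh') !cardsU1 !inE.
rewrite !ffunE tpermL tpermR xh xh' [h' == h]eq_sym (negPf hh').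
by [].
Qed.

(** The glued graph has one more constraint on its closed sets; everything
    about its connectedness follows from this. *)
Lemma hclosed_toggle h h' x S : flipK x -> x.2 h = h -> x.2 h' = h' ->
  hclosed (toggle h h' x) S = hclosed x S && ((x.1 h \in S) == (x.1 h' \in S)).
Proof.
move=> /flipKP fK xh xh'; apply/hclosedP/andP => [cS|[/hclosedP cS /eqP Shh'] z].
  have Shh' : (x.1 h \in S) = (x.1 h' \in S).
    by have := cS h; rewrite /= ffunE tpermL xh'.
  split; last by apply/eqP.
  apply/hclosedP => z; have := cS z; rewrite /= ffunE.
  by case: tpermP => [->|->|_ _ //]; rewrite ?xh ?xh'.
rewrite /= ffunE; case: tpermP => [->|->|_ _]; rewrite ?xh ?xh' -?Shh' //.
Qed.

(** The graph has exactly two components, S and its complement, and h and h'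
    are attached to S and to its complement respectively. *)
Definition separated h h' x S :=
  [&& hcomponent x S, hcomponent x (~: S), x.1 h \in S & x.1 h' \notin S].

Lemma separated_toggle h h' x S : flipK x -> x.2 h = h -> x.2 h' = h' ->
  separated h h' x S -> hconn (toggle h h' x).
Proof.
move=> fK xh xh' /and4P[c1 c2 hS h'S].
apply/hconnP; split.
  by apply/set0Pn; exists (x.1 h); rewrite inE.
move=> S'; rewrite hclosed_toggle // => /andP[cS' /eqP hE].
case: (hcomponentI c1 cS') => [d1|s1]; case: (hcomponentI c2 cS') => [d2|s2].
- left; apply/setP => v; rewrite inE; case: (boolP (v \in S)) => vS.
    by rewrite (disjointFr d1).
  by rewrite (disjointFr d2) // inE.
- have := subsetP s2 (x.1 h'); rewrite inE -hE => /(_ h'S).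
  by rewrite (disjointFr d1).
- have := disjointFr d2 (_ : x.1 h' \in ~: S); rewrite inE -hE => /(_ h'S).
  by rewrite (subsetP s1 _ hS).
- right; apply/setP => v; rewrite inE; case: (boolP (v \in S)) => vS.
    by rewrite (subsetP s1).
  by rewrite (subsetP s2) // inE.
Qed.

Lemma separated_uniq h h' x S1 S2 : separated h h' x S1 -> separated h h' x S2 -> S1 = S2.
Proof.
move=> /and4P[a1 b1 hS1 h'S1] /and4P[a2 b2 hS2 h'S2].
have /hcomponentP[_ c1 _] := a1; have /hcomponentP[_ c2 _] := a2.
apply/eqP; rewrite eqEsubset; apply/andP; split.
  by case: (hcomponentI a1 c2) => // d; move: hS2; rewrite (disjointFr d).
by case: (hcomponentI a2 c1) => // d; move: hS1; rewrite (disjointFr d).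
Qed.

Lemma separated_disconnected h h' x S : separated h h' x S -> ~~ hconn x.
Proof.
move=> /and4P[/hcomponentP[_ cS _] _ hS h'S]; apply/negP => /hconnP[_ /(_ _ cS)[E|E]].
  by rewrite E inE in hS.
by rewrite E inE in h'S.
Qed.

(** A closed set which is neither empty nor full in the graph before gluing
    must contain exactly one of the ends of h and h', since it would remain
    closed otherwise.  The same argument applied to the differences S :\: S'
    with S' closed in S shows that S and its complement are components. *)
Lemma toggle_connected_separated h h' x : flipK x -> x.2 h = h -> x.2 h' = h' ->
  hconn (toggle h h' x) -> ~~ hconn x -> exists S, separated h h' x S.
Proof.
move=> fK xh xh' /hconnP[V0 cT] nx.
have triv S : hclosed x S -> (x.1 h \in S) = (x.1 h' \in S) -> S = set0 \/ S = setT.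
  by move=> cS hE; apply: cT; rewrite hclosed_toggle // cS hE eqxx.
have sep S : hclosed x S -> x.1 h \in S -> x.1 h' \notin S -> hcomponent x S.
  move=> cS hS h'S; apply/hcomponentP; split=> //.
    by apply/set0Pn; exists (x.1 h).
  move=> S' cS' sS.
  have h'S' : x.1 h' \notin S' by apply: contra h'S; apply: (subsetP sS).
  case: (boolP (x.1 h \in S')) => hS'.
    right; apply/eqP; rewrite eqEsubset sS /= -setD_eq0 setDE.
    case: (triv (S :&: ~: S')) => [||->//|E].
    - exact: hclosedI (hclosedC _).
    - by rewrite !inE hS' (negPf h'S) andbF.
    - by have := in_setT (x.1 h'); rewrite -E !inE (negPf h'S).
  by case: (triv S') => [//||E|E]; [rewrite (negPf hS') (negPf h'S')|left|
    move: hS'; rewrite E inE].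
have sep' S : hclosed x S -> x.1 h \in S -> x.1 h' \notin S -> hcomponent x (~: S).
  move=> cS hS h'S; apply/hcomponentP; split.
  - by apply/set0Pn; exists (x.1 h'); rewrite inE.
  - exact: hclosedC.
  move=> S' cS' sS.
  have hS' : x.1 h \notin S'.
    by apply/negP => /(subsetP sS); rewrite inE hS.
  case: (boolP (x.1 h' \in S')) => h'S'.
    right; apply/eqP; rewrite eqEsubset sS /= -setD_eq0 setDE.
    case: (triv (~: S :&: ~: S')) => [||->//|E].
    - exact: hclosedI (hclosedC _) (hclosedC _).
    - by rewrite !inE hS h'S' andbF.
    - by have := in_setT (x.1 h); rewrite -E !inE hS.
  by case: (triv S') => [//||E|E]; [rewrite (negPf hS') (negPf h'S')|left|
    move: hS'; rewrite E inE].
(* S may be replaced by its complement to have h on its side *)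
have [S cS [S0 ST]] : exists2 S, hclosed x S & S <> set0 /\ S <> setT.
  case: (boolP [exists S, [&& hclosed x S, S != set0 & S != setT]]).
    by case/existsP => S /and3P[cS /eqP S0 /eqP ST]; exists S.
  rewrite negb_exists => /forallP nS; case/negP: nx; apply/hconnP; split=> // S cS.
  by move: (nS S); rewrite cS /= negb_and !negbK => /orP[] /eqP; [left|right].
case: (boolP (x.1 h \in S)) => hS; case: (boolP (x.1 h' \in S)) => h'S.
- by case: (triv S cS); rewrite ?hS ?h'S.
- by exists S; rewrite /separated sep ?sep' ?hS ?h'S.
- have [cS' hS' h'S'] : [/\ hclosed x (~: S), x.1 h \in ~: S & x.1 h' \notin ~: S].
    by rewrite !inE hS h'S; split=> //; apply: hclosedC.
  by exists (~: S); rewrite /separated sep // sep' // hS' h'S'.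
- by case: (triv S cS); rewrite ?(negPf hS) ?(negPf h'S).
Qed.

(** A case distinction written as a sum, so that it can be multiplied by weights
    and exchanged with other sums. *)
Lemma hconn_toggle (R : pzSemiRingType) h h' x : flipK x -> x.2 h = h -> x.2 h' = h' ->
  (hconn (toggle h h' x))%:R = (hconn x)%:R + \sum_S (separated h h' x S)%:R :> R.
Proof.
move=> fK xh xh'; case: (boolP (hconn x)) => cx.
  rewrite big1 => [|S _]; last first.
    by case: (boolP (separated _ _ _ _)) => // /separated_disconnected; rewrite cx.
  suff -> : hconn (toggle h h' x) by rewrite addr0.
  case/hconnP: cx => V0 cT; apply/hconnP; split=> // S.
  by rewrite hclosed_toggle // => /andP[/cT].
rewrite add0r; case: (boolP (hconn (toggle h h' x))) => ct.
  have [S sS] := toggle_connected_separated fK xh xh' ct cx.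
  rewrite (bigD1 S) //= sS big1 ?addr0 // => S' S'S.
  case: (boolP (separated _ _ _ _)) => // sS'.
  by case/eqP: S'S; apply: separated_uniq sS' sS.
rewrite big1 // => S _; case: (boolP (separated _ _ _ _)) => // sS.
by move: ct; rewrite (separated_toggle fK xh xh' sS).
Qed.

End HGraph.

(** * Embedded components *)
Section Embedding.
Variables V1 H1 V H : finType.

(** An isomorphism from x1 to the part of x over the image of i.  The case
    where i and j are bijective is that of isomorphisms of graphs, so the
    invariance of valences, legs and connectedness is proved here once. *)
Record embedding (i : V1 -> V) (j : H1 -> H) (x1 : hgraph V1 H1) (x : hgraph V H) : Prop :=
  Embedding {
    emb_injv : injective i;
    emb_injh : injective j;
    emb_root : forall h, x.1 (j h) = i (x1.1 h);
    emb_flip : forall h, x.2 (j h) = j (x1.2 h);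
    emb_full : forall h v, x.1 h = i v -> exists h1, h = j h1 }.

Variables (i : V1 -> V) (j : H1 -> H) (x1 : hgraph V1 H1) (x : hgraph V H).
Hypothesis e : embedding i j x1 x.

Lemma emb_val v : hvalence x (i v) = hvalence x1 v.
Proof.
rewrite /hvalence -(card_imset _ (emb_injh e)); apply: eq_card => h.
rewrite !inE; apply/eqP/imsetP => [xh|[h1]].
  have [h1 hE] := emb_full e xh; exists h1 => //; rewrite inE.
  by apply/eqP; apply: (emb_injv e); rewrite -(emb_root e) -hE.
by rewrite inE => /eqP <- ->; rewrite (emb_root e).
Qed.

Lemma emb_legs : hlegs x :&: (x.1 @^-1: (i @: setT)) = j @: hlegs x1.
Proof.
apply/setP => h; rewrite !inE; apply/andP/imsetP.
  case=> /eqP xh /imsetP[v _ /(emb_full e)[h1 hE]]; exists h1 => //.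
  by rewrite inE; apply/eqP; apply: (emb_injh e); rewrite -(emb_flip e) -hE.
case=> h1; rewrite inE => /eqP xh ->; rewrite (emb_flip e) xh eqxx; split=> //.
by rewrite (emb_root e) imset_f.
Qed.

Lemma emb_card_legs : #|hlegs x :&: (x.1 @^-1: (i @: setT))| = #|hlegs x1|.
Proof. by rewrite emb_legs; apply: card_imset; apply: (emb_injh e). Qed.

Lemma emb_flipK : flipK x -> flipK x1.
Proof.
move/flipKP=> fK; apply/flipKP => h; apply: (emb_injh e).
by rewrite -!(emb_flip e) fK.
Qed.

Lemma emb_closed (S : {set V1}) : flipK x -> hclosed x (i @: S) = hclosed x1 S.
Proof.
move/flipKP=> fK; apply/hclosedP/hclosedP => cS h.
  by have := cS (j h); rewrite (emb_flip e) !(emb_root e) !(mem_imset _ _ (emb_injv e)).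
have sub h0 : (x.1 h0 \in i @: S) -> (x.1 (x.2 h0) \in i @: S).
  case/imsetP => v vS xh; have [h1 hE] := emb_full e xh.
  rewrite hE (emb_flip e) (emb_root e) (mem_imset _ _ (emb_injv e)) -cS.
  suff -> : x1.1 h1 = v by [].
  by apply: (emb_injv e); rewrite -(emb_root e) -hE.
by apply/idP/idP => /sub; rewrite ?fK.
Qed.

Lemma emb_comp : flipK x -> hcomponent x (i @: setT) = hconn x1.
Proof.
move=> fK; apply/hcomponentP/hconnP => [[V0 _ cS]|[V0 cS]]; split.
- by apply: contraNneq V0 => ->; rewrite imset0.
- move=> S cS1; case: (cS (i @: S)); rewrite ?emb_closed ?imsetS //.
    by move=> /eqP; rewrite imset_eq0 => /eqP; left.
  by move=> iS; right; apply: (imset_inj (emb_injv e)).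
- by rewrite imset_eq0.
- by rewrite emb_closed //; apply: hclosedT.
move=> S cSx /subsetP sS.
have SE : S = i @: (i @^-1: S).
  apply/setP => v; apply/idP/imsetP => [vS|[u]]; last by rewrite inE => uS ->.
  by have /imsetP[u _ vE] := sS v vS; exists u => //; rewrite inE -vE.
case: (cS (i @^-1: S)); first by rewrite -emb_closed // -SE.
  by move=> E; left; rewrite SE E imset0.
by move=> E; right; rewrite SE E.
Qed.

End Embedding.

(** * The edge-cutting recursion for labelled graphs *)
Section ConnSum.
Variables (R : comNzRingType) (W : nat -> R).

Definition hweight (V H : finType) (x : hgraph V H) : R := \prod_v W (hvalence x v).

(** Connected graphs on p labelled vertices and q labelled half-edges, n of
    which are legs, a vertex of valence m being weighted by W m. *)
Definition conn_sum (p q n : nat) : R :=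
  \sum_(x : hgraph 'I_p 'I_q | [&& flipK x, hconn x & #|hlegs x| == n]) hweight x.

Lemma sum_sets_by_card p (G : nat -> R) :
  \sum_(S : {set 'I_p}) G #|S| = \sum_(k < p.+1) 'C(p, k)%:R * G k.
Proof.
pose f (S : {set 'I_p}) : 'I_p.+1 := inord #|S|.
have fE S : f S = #|S| :> nat.
  by rewrite inordK // ltnS -[X in (_ <= X)%N](card_ord p) max_card.
rewrite (partition_big f predT) //=; apply: eq_bigr => k _.
rewrite (eq_bigr (fun _ => G k)) => [|S /eqP <-]; last by rewrite fE.
have -> : 'C(p, k) = #|[set A : {set 'I_p} | #|A| == k]| by rewrite card_draws card_ord.
rewrite -sum1dep_card natr_sum mulr_suml.
apply: eq_big => [S|S _]; last by rewrite mul1r.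
by rewrite -val_eqE /= fE.
Qed.

Section Split.
Variables (p q : nat) (S : {set 'I_p}) (T : {set 'I_q}).
Let V1 : finType := 'I_#|S|.
Let V2 : finType := 'I_#|~: S|.
Let H1 : finType := 'I_#|T|.
Let H2 : finType := 'I_#|~: T|.
Let i1 : V1 -> 'I_p := enum_val.
Let i2 : V2 -> 'I_p := enum_val.
Let j1 : H1 -> 'I_q := enum_val.
Let j2 : H2 -> 'I_q := enum_val.

Let imE (n : nat) (A : {set 'I_n}) : (@enum_val _ (mem A)) @: setT = A.
Proof.
apply/setP => v; apply/imsetP/idP => [[u _ ->]|vA]; first exact: enum_valP.
by exists (enum_rank_in vA v); rewrite ?inE // enum_rankK_in.
Qed.

(** Any two graphs can be put side by side on S and its complement.  Together
    with [restrictP] this makes pairs of graphs correspond to the graphs in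
    which S is closed. *)
Lemma joinP (a : hgraph V1 H1 * hgraph V2 H2) :
  exists x : hgraph 'I_p 'I_q, embedding i1 j1 a.1 x /\ embedding i2 j2 a.2 x.
Proof.
have ri1 : forall v, i1 v \in S by move=> v; apply: enum_valP.
have ri2 : forall v, i2 v \notin S.
  by move=> v; have := enum_valP v; rewrite inE.
have rj1 : forall v, j1 v \in T by move=> v; apply: enum_valP.
have rj2 : forall v, j2 v \notin T.
  by move=> v; have := enum_valP v; rewrite inE.
(* the maps are built pointwise by finite choice, since there is no default
   value when p or q is 0 *)
have ex h : exists y : 'I_p * 'I_q,
    (forall h1, h = j1 h1 -> y = (i1 (a.1.1 h1), j1 (a.1.2 h1))) /\
    (forall h2, h = j2 h2 -> y = (i2 (a.2.1 h2), j2 (a.2.2 h2))).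
  case: (boolP (h \in T)) => hT.
    have : h \in j1 @: setT by rewrite imE.
    case/imsetP => h1 _ hE; exists (i1 (a.1.1 h1), j1 (a.1.2 h1)); split=> h'.
      by rewrite hE => /enum_val_inj ->.
    by move=> h'E; move: hT; rewrite h'E (negPf (rj2 _)).
  have : h \in j2 @: setT by rewrite imE inE.
  case/imsetP => h1 _ hE; exists (i2 (a.2.1 h1), j2 (a.2.2 h1)); split=> h'.
    by move=> h'E; move: hT; rewrite h'E rj1.
  by rewrite hE => /enum_val_inj ->.
have [y yP] := fin_all_exists ex.
have y1 h : y (j1 h) = (i1 (a.1.1 h), j1 (a.1.2 h)) by apply: (yP _).1.
have y2 h : y (j2 h) = (i2 (a.2.1 h), j2 (a.2.2 h)) by apply: (yP _).2.
exists ([ffun h => (y h).1], [ffun h => (y h).2]).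
have cover h : (exists h1, h = j1 h1) \/ (exists h2, h = j2 h2).
  case: (boolP (h \in T)) => hT; [left|right].
    have : h \in j1 @: setT by rewrite imE.
    by case/imsetP => h1 _ ->; exists h1.
  have : h \in j2 @: setT by rewrite imE inE.
  by case/imsetP => h1 _ ->; exists h1.
split; split; try exact: enum_val_inj; try by (move=> h; rewrite ffunE ?y1 ?y2).
  move=> h v; rewrite ffunE; case: (cover h) => // -[h2 ->]; rewrite y2 /= => E.
  by have := ri2 (a.2.1 h2); rewrite E ri1.
move=> h v; rewrite ffunE; case: (cover h) => // -[h2 ->]; rewrite y1 /= => E.
by have := ri1 (a.1.1 h2); rewrite E (negPf (ri2 _)).
Qed.

Lemma enum_val_ex (n : nat) (A : {set 'I_n}) (u : 'I_n) : u \in A ->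
  exists u1 : 'I_#|A|, u = enum_val u1.
Proof. by rewrite -{1}[A]imE => /imsetP[u1 _ ->]; exists u1. Qed.

Lemma restrictP (A : {set 'I_p}) (x : hgraph 'I_p 'I_q) :
  hclosed x A ->
  exists x1 : hgraph 'I_#|A| 'I_#|x.1 @^-1: A|,
    embedding enum_val enum_val x1 x.
Proof.
move=> /hclosedP cA.
have rA (h : 'I_#|x.1 @^-1: A|) : exists y : 'I_#|A| * 'I_#|x.1 @^-1: A|,
   x.1 (enum_val h) = enum_val y.1 /\ x.2 (enum_val h) = enum_val y.2.
  have := enum_valP h; rewrite inE => hA.
  have [v vE] := enum_val_ex hA.
  have : x.2 (enum_val h) \in x.1 @^-1: A by rewrite inE -cA.
  by case/enum_val_ex => h1 h1E; exists (v, h1).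
have [y yP] := fin_all_exists rA.
exists ([ffun h => (y h).1], [ffun h => (y h).2]); split; try exact: enum_val_inj.
- by move=> h; rewrite ffunE (yP h).1.
- by move=> h; rewrite ffunE (yP h).2.
- move=> h v hE; apply: enum_val_ex.
  by rewrite inE hE enum_valP.
Qed.

Definition splits (x : hgraph 'I_p 'I_q) :=
  [&& flipK x, hcomponent x S, hcomponent x (~: S) & T == x.1 @^-1: S].

Lemma join_flipK a x : embedding i1 j1 a.1 x -> embedding i2 j2 a.2 x ->
  flipK x = flipK a.1 && flipK a.2.
Proof.
move=> e1 e2; apply/idP/andP => [fK|[/flipKP f1 /flipKP f2]].
  by split; [apply: emb_flipK e1 fK|apply: emb_flipK e2 fK].
apply/flipKP => h; case: (boolP (h \in T)) => hT.
  have [h1 ->] := enum_val_ex hT.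
  by rewrite -/(j1 h1) !(emb_flip e1) f1.
have : h \in ~: T by rewrite inE.
case/enum_val_ex => h1 ->.
by rewrite -/(j2 h1) !(emb_flip e2) f2.
Qed.

Lemma join_preim a x : embedding i1 j1 a.1 x -> embedding i2 j2 a.2 x ->
  x.1 @^-1: S = T.
Proof.
move=> e1 e2; apply/setP => h; rewrite inE; case: (boolP (h \in T)) => hT.
  have [h1 ->] := enum_val_ex hT.
  by rewrite -/(j1 h1) (emb_root e1) enum_valP.
have : h \in ~: T by rewrite inE.
case/enum_val_ex => h1 ->; rewrite -/(j2 h1) (emb_root e2).
by have := enum_valP (a.2.1 h1); rewrite inE => /negPf.
Qed.

Lemma join_inj a b x : embedding i1 j1 a.1 x -> embedding i2 j2 a.2 x ->
  embedding i1 j1 b.1 x -> embedding i2 j2 b.2 x -> a = b.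
Proof.
case: a b => [[a1 a2] [a3 a4]] [[b1 b2] [b3 b4]] /= ea ea' eb eb'.
congr (_, _, (_, _)); apply/ffunP => h.
- by apply: (emb_injv ea); rewrite -(emb_root ea) -(emb_root eb).
- by apply: (emb_injh ea); rewrite -(emb_flip ea) -(emb_flip eb).
- by apply: (emb_injv ea'); rewrite -(emb_root ea') -(emb_root eb').
- by apply: (emb_injh ea'); rewrite -(emb_flip ea') -(emb_flip eb').
Qed.

Lemma join_weight a x : embedding i1 j1 a.1 x -> embedding i2 j2 a.2 x ->
  hweight x = hweight a.1 * hweight a.2.
Proof.
move=> e1 e2; rewrite /hweight (bigID (mem S)) /=; congr (_ * _).
  rewrite big_enum_val; apply: eq_bigr => v _.
  by rewrite -/(i1 v) (emb_val e1).
rewrite (eq_bigl (fun v => v \in ~: S)) => [|v]; last by rewrite inE.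
rewrite big_enum_val; apply: eq_bigr => v _.
by rewrite -/(i2 v) (emb_val e2).
Qed.

Lemma join_splits a x : embedding i1 j1 a.1 x -> embedding i2 j2 a.2 x ->
  splits x = [&& flipK a.1, flipK a.2, hconn a.1 & hconn a.2].
Proof.
move=> e1 e2; rewrite [RHS]andbA -(join_flipK e1 e2) /splits; case: (boolP (flipK x)) => //= fK.
rewrite -(emb_comp e1 fK) -(emb_comp e2 fK) !imE (join_preim e1 e2) eqxx andbT.
by [].
Qed.

(** The two marked legs, one on each side, contribute the product of the
    numbers of legs of the two components. *)
Lemma split_sum m :
  \sum_(x : hgraph 'I_p 'I_q | splits x && (#|hlegs x| == m))
     hweight x * (#|hlegs x :&: T| * #|hlegs x :&: ~: T|)%:R
  = \sum_(n1 < m.+1) (n1 * (m - n1))%:R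
      * (conn_sum #|S| #|T| n1 * conn_sum #|~: S| #|~: T| (m - n1)).
Proof.
have [jn jnP] := fin_all_exists joinP.
have e1 a := (jnP a).1; have e2 a := (jnP a).2.
have l1 a : #|hlegs (jn a) :&: T| = #|hlegs a.1|.
  by rewrite -(emb_card_legs (e1 a)) imE (join_preim (e1 a) (e2 a)).
have l2 a : #|hlegs (jn a) :&: ~: T| = #|hlegs a.2|.
  by rewrite -(emb_card_legs (e2 a)) imE preimsetC (join_preim (e1 a) (e2 a)).
have l a : #|hlegs (jn a)| = (#|hlegs a.1| + #|hlegs a.2|)%N.
  by rewrite -(cardsID T) l1 setDE l2.
pose ok (a : hgraph V1 H1 * hgraph V2 H2) :=
  [&& flipK a.1, flipK a.2, hconn a.1 & hconn a.2]
  && (#|hlegs a.1| + #|hlegs a.2| == m)%N.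
transitivity (\sum_(x in jn @: [set a | ok a])
    hweight x * (#|hlegs x :&: T| * #|hlegs x :&: ~: T|)%:R).
  apply: eq_bigl => x; apply/andP/imsetP => [[sx lx]|[a]]; last first.
    by rewrite inE => /andP[ok1 ok2] ->; rewrite (join_splits (e1 a) (e2 a)) l.
  suff [a xE] : exists a, x = jn a.
    exists a => //; rewrite inE /ok -(join_splits (e1 a) (e2 a)) -l.
    by rewrite -xE sx lx.
  case/and4P: sx => /flipKP fK /hcomponentP[_ c1 _] /hcomponentP[_ c2 _] /eqP TE.
  have [x1] := restrictP c1; have [x2] := restrictP c2.
  move: x1 x2; rewrite preimsetC -TE => x1 x2 ex2 ex1; exists (x1, x2).
  have := e1 (x1, x2); have := e2 (x1, x2); set y := jn _ => ey2 ey1.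
  case: x y ex1 ex2 ey1 ey2 {fK c1 c2 TE lx} => [a b] [c d] ex1 ex2 ey1 ey2.
  congr (_, _); apply/ffunP => h; case: (boolP (h \in T)) => hT.
  - have [h1 ->] := enum_val_ex hT.
    by have := emb_root ex1 h1; have := emb_root ey1 h1 => /= -> ->.
  - have : h \in ~: T by rewrite inE.
    case/enum_val_ex => h1 ->.
    by have := emb_root ex2 h1; have := emb_root ey2 h1 => /= -> ->.
  - have [h1 ->] := enum_val_ex hT.
    by have := emb_flip ex1 h1; have := emb_flip ey1 h1 => /= -> ->.
  - have : h \in ~: T by rewrite inE.
    case/enum_val_ex => h1 ->.
    by have := emb_flip ex2 h1; have := emb_flip ey2 h1 => /= -> ->.
rewrite big_imset /=; last first.
  move=> a b _ _ E; apply: (join_inj (e1 a) (e2 a)); rewrite E; [exact: e1|exact: e2].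
transitivity (\sum_(a | ok a) (hweight a.1 * hweight a.2 * (#|hlegs a.1| * #|hlegs a.2|)%:R)).
  apply: eq_big => a; first by rewrite inE.
  by move=> _; rewrite (join_weight (e1 a) (e2 a)) l1 l2.
transitivity (\sum_(n1 < m.+1) \sum_(a | ok a && (#|hlegs a.1| == n1 :> nat))
  (hweight a.1 * hweight a.2 * (#|hlegs a.1| * #|hlegs a.2|)%:R)).
  rewrite (partition_big (fun a => inord #|hlegs a.1| : 'I_m.+1) predT) //=.
  apply: eq_bigr => n1 _; apply: eq_bigl => a.
  case: (boolP (ok a)) => //= /andP[_ /eqP lm].
  by rewrite -val_eqE /= inordK // ltnS -lm leq_addr.
apply: eq_bigr => n1 _; rewrite /conn_sum mulr_suml mulr_sumr.
under [RHS]eq_bigr do rewrite mulr_sumr mulr_sumr.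
rewrite pair_big /=; apply: eq_big => [a|a /andP[/andP[_ /eqP lm] /eqP ln]].
  have : (n1 <= m)%N by rewrite -ltnS.
  rewrite /ok; case: (flipK a.1); case: (flipK a.2); case: (hconn a.1); case: (hconn a.2);
    rewrite ?andbF //= => nm.
  move: #|hlegs a.1| #|hlegs a.2| => c1 c2.
  by apply/andP/andP => -[/eqP l1E /eqP l2E]; split; apply/eqP; lia.
have -> : (m - n1)%N = #|hlegs a.2| by rewrite -ln -lm addKn.
by rewrite mulrC ln.
Qed.

End Split.

(** Connected graphs with an edge {h, h'} correspond under [toggle] to graphs
    with two more legs, h and h' among them, which become connected when h is
    glued to h'. *)
Lemma cut_marked p q n (h h' : 'I_q) : h != h' ->
  \sum_(x : hgraph 'I_p 'I_q | [&& flipK x, hconn x & #|hlegs x| == n] && (x.2 h == h'))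
     hweight x =
  \sum_(x : hgraph 'I_p 'I_q | flipK x && (#|hlegs x| == n.+2))
     hweight x * ((h \in hlegs x) && (h' \in hlegs x))%:R
     * ((hconn x)%:R + \sum_S (separated h h' x S)%:R).
Proof.
move=> hh'; rewrite (reindex_inj (inv_inj (toggleK h h'))) /=.
rewrite big_mkcond [RHS]big_mkcond; apply: eq_bigr => x _.
rewrite -[hweight (toggle h h' x)]/(hweight x) ffunE tpermL.
rewrite !inE; case: (x.2 h' =P h') => xh'; last by rewrite !andbF mulr0 mul0r if_same.
rewrite !andbT; case: (x.2 h =P h) => xh; last first.
  rewrite mulr0 mul0r if_same.
  case: (boolP (flipK (toggle h h' x))) => //= /flipKP fK; case: xh.
  by have := fK h; rewrite /= !ffunE tpermL xh' tpermR.
rewrite mulr1.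
case: (boolP (flipK x)) => fK; last first.
  case: (boolP (flipK (toggle h h' x))) => //= fK'.
  case/negP: fK; rewrite -(toggleK h h' x); apply: flipK_toggleV => //.
  by rewrite /= ffunE tpermL.
rewrite flipK_toggle //= (card_hlegs_toggle hh' xh xh') !eqSS -hconn_toggle //.
by case: (hconn _); case: (_ == _); rewrite /= ?mulr1 ?mulr0.
Qed.

Lemma sum_marked_pairs (q : nat) (A : {set 'I_q}) :
  (\sum_(h : 'I_q) \sum_(h' | h != h') ((h \in A) && (h' \in A)) = #|A| * #|A|.-1)%N.
Proof.
rewrite (bigID (mem A)) /= [X in (_ + X)%N]big1 => [|h /negPf hA]; last first.
  by rewrite big1 // => h'; rewrite hA.
rewrite addn0 -sum_nat_const; apply: eq_bigr => h hA.
under eq_bigr do rewrite hA /=.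
rewrite (cardsD1 h) hA /= -sum1_card big_mkcond [RHS]big_mkcond /=.
by apply: eq_bigr => h' _; rewrite !inE eq_sym; case: (_ == _) => //; case: (_ \in _).
Qed.

Lemma sum_separated (p q : nat) (x : hgraph 'I_p 'I_q) (S : {set 'I_p}) :
  flipK x ->
  (\sum_(h : 'I_q) \sum_(h' | h != h')
     ((h \in hlegs x) && (h' \in hlegs x)) * separated h h' x S =
  \sum_T splits S T x * (#|hlegs x :&: T| * #|hlegs x :&: ~: T|))%N.
Proof.
move=> fK; rewrite [RHS](bigD1 (x.1 @^-1: S)) //= [X in (_ + X)%N]big1 => [|T /negPf TS]; last first.
  by rewrite /splits TS !andbF.
rewrite addn0 /splits eqxx fK /= andbT.
rewrite -!sum1_card big_distrl /= big_distrr /= [RHS]big_mkcond.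
apply: eq_bigr => h _; rewrite mul1n big_distrr /= big_mkcond.
case: ifP => hin; last first.
  rewrite big1 // => h' _; case: ifP => // _; rewrite /separated.
  by move: hin; rewrite !inE; case: (_ == _) => //= ->; rewrite /= ?andbF ?muln0.
rewrite [RHS]big_mkcond; apply: eq_bigr => h' _.
move: hin; rewrite !inE => /andP[hl hS]; rewrite hl /separated hS /=.
case: (boolP (x.1 h' \in S)) => h'S; rewrite ?andbF ?andbT /= ?muln0 ?if_same //.
have -> : h != h' by apply: contraNneq h'S => <-.
by case: (_ == _); rewrite ?mul1n ?muln1 ?andbT.
Qed.

(** Both sides count connected graphs with an ordered pair (h, h') of
    half-edges forming an edge: there are q - n choices of h, and h determines
    h'.  On the right the edge has been cut. *)
Theorem cut_recursion p q n :
  (q%:R - n%:R) * conn_sum p q n =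
  (n.+2 * n.+1)%:R * conn_sum p q n.+2
  + \sum_(p1 < p.+1) \sum_(q1 < q.+1) ('C(p, p1) * 'C(q, q1))%:R *
     \sum_(n1 < n.+3) (n1 * (n.+2 - n1))%:R
       * (conn_sum p1 q1 n1 * conn_sum (p - p1) (q - q1) (n.+2 - n1)).
Proof.
transitivity (\sum_(h : 'I_q) \sum_(h' | h != h')
  \sum_(x : hgraph 'I_p 'I_q | [&& flipK x, hconn x & #|hlegs x| == n] && (x.2 h == h'))
     hweight x).
  rewrite /conn_sum mulr_sumr.
  transitivity (\sum_(x : hgraph 'I_p 'I_q | [&& flipK x, hconn x & #|hlegs x| == n])
    \sum_(h : 'I_q) \sum_(h' | h != h') (if x.2 h == h' then hweight x else 0)).
    apply: eq_bigr => x /and3P[_ _ /eqP lx].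
    transitivity (\sum_(h in ~: hlegs x) hweight x).
      rewrite sumr_const -[RHS]mulr_natl; congr (_ * _).
      by rewrite cardsCs setCK card_ord lx natrB // -lx -[X in (_ <= X)%N](card_ord q) max_card.
    rewrite big_mkcond; apply: eq_bigr => h _; rewrite !inE -big_mkcondr /=.
    case: ifP => xh.
      rewrite (big_pred1 (x.2 h)) // => h'; rewrite andbC /= [RHS]eq_sym.
      by case: (x.2 h =P h') => // <-; rewrite eq_sym xh.
    rewrite big_pred0 // => h'; move/negbFE/eqP: xh => ->.
    by case: (h == h').
  rewrite exchange_big; apply: eq_bigr => h _; rewrite exchange_big; apply: eq_bigr => h' _.
  by rewrite [RHS]big_mkcondr.
under eq_bigr => h _ do under eq_bigr => h' hh' do rewrite cut_marked //.
(* for each graph, the pairs (h, h') are now counted *)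
transitivity (\sum_(x : hgraph 'I_p 'I_q | flipK x && (#|hlegs x| == n.+2))
   (hweight x * ((n.+2 * n.+1)%:R * (hconn x)%:R) +
    \sum_S \sum_T hweight x * (splits S T x * (#|hlegs x :&: T| * #|hlegs x :&: ~: T|))%:R)).
  under eq_bigr do rewrite exchange_big /=.
  rewrite exchange_big /=; apply: eq_bigr => x /andP[fK /eqP lx].
  under eq_bigr do under eq_bigr do rewrite mulrDr.
  under eq_bigr do rewrite big_split /=.
  rewrite big_split /=; congr (_ + _).
    under eq_bigr do rewrite -mulr_suml -mulr_sumr -natr_sum.
    by rewrite -mulr_suml -mulr_sumr -natr_sum sum_marked_pairs lx mulrA.
  under [RHS]eq_bigr do rewrite -mulr_sumr -natr_sum -sum_separated //.
  rewrite -mulr_sumr -natr_sum.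
  under eq_bigr do under eq_bigr do rewrite -mulrA -natr_sum -natrM.
  under eq_bigr do rewrite -mulr_sumr -natr_sum.
  rewrite -mulr_sumr -natr_sum; congr (_ * _%:R).
  rewrite [RHS]exchange_big; apply: eq_bigr => h _.
  rewrite [RHS]exchange_big; apply: eq_bigr => h' _.
  by rewrite big_distrr.
rewrite big_split /=; congr (_ + _).
  rewrite /conn_sum mulr_sumr.
  rewrite (bigID (@hconn _ _)) /= addrC big1 ?add0r => [|x /andP[_ /negPf->]]; last first.
    by rewrite !mulr0.
  apply: eq_big => [x|x /andP[_ ->]]; first by rewrite -andbA [in LHS](andbC (_ == _)).
  by rewrite mulr1 mulrC.
rewrite exchange_big /=; under eq_bigr do rewrite exchange_big /=.
transitivity (\sum_(S : {set 'I_p}) \sum_(T : {set 'I_q})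
   \sum_(n1 < n.+3) (n1 * (n.+2 - n1))%:R
      * (conn_sum #|S| #|T| n1 * conn_sum (p - #|S|) (q - #|T|) (n.+2 - n1))).
  apply: eq_bigr => S _; apply: eq_bigr => T _.
  have -> : (p - #|S|)%N = #|~: S| by rewrite [RHS]cardsCs setCK card_ord.
  have -> : (q - #|T|)%N = #|~: T| by rewrite [RHS]cardsCs setCK card_ord.
  rewrite -split_sum big_mkcond [RHS]big_mkcond; apply: eq_bigr => x _.
  rewrite /splits; case: (flipK x) => //=.
  by case: (_ == n.+2); rewrite ?andbT ?andbF //; case: ifP; rewrite ?mul1n // mul0n mulr0.
pose G p1 q1 := \sum_(n1 < n.+3) (n1 * (n.+2 - n1))%:R
      * (conn_sum p1 q1 n1 * conn_sum (p - p1) (q - q1) (n.+2 - n1)).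
transitivity (\sum_(S : {set 'I_p}) \sum_(k < q.+1) 'C(q, k)%:R * G #|S| k).
  by apply: eq_bigr => S _; rewrite -(sum_sets_by_card q (G #|S|)).
rewrite (sum_sets_by_card p (fun p1 => \sum_(k < q.+1) 'C(q, k)%:R * G p1 k)).
apply: eq_bigr => p1 _; rewrite mulr_sumr; apply: eq_bigr => q1 _.
by rewrite mulrA -natrM.
Qed.

End ConnSum.

(** * The first Betti number *)
Section Edges.
Variables V H : finType.
Implicit Types x : hgraph V H.

Definition hedges x : {set {set H}} := [set [set h; x.2 h] | h in ~: hlegs x].

Lemma card_flags x : flipK x -> #|H| = (2 * #|hedges x| + #|hlegs x|)%N.
Proof.
move=> /flipKP fK; rewrite -(cardsC (hlegs x)) addnC; congr (_ + _)%N.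
rewrite -sum1_card (partition_big_imset (fun h => [set h; x.2 h])) /=.
rewrite -/(hedges x) mulnC -sum_nat_const; apply: eq_bigr => e.
case/imsetP => h; rewrite inE => hl ->.
have xh : h != x.2 h by move: hl; rewrite inE eq_sym.
(* the half-edges giving the same edge as h are h and its other half *)
rewrite sum1dep_card -[RHS](_ : #|[set h; x.2 h]| = 2); last by rewrite cards2 xh.
apply: eq_card => h'; rewrite !inE; apply/andP/orP.
  case=> _ /eqP E; have := set21 h' (x.2 h'); rewrite E !inE.
  by case/orP => ->; [left|right].
case=> /eqP ->; first by rewrite eqxx eq_sym.
by rewrite fK xh setUC eqxx.
Qed.

Lemma hconn_noedge x : #|hlegs x| = #|H| -> hconn x -> #|V| = 1%N.
Proof.
move=> lT /hconnP[/set0Pn[v _] cS].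
have xE h : x.2 h = h.
  have : hlegs x == setT by rewrite eqEcard subsetT cardsT lT leqnn.
  by move/eqP/setP/(_ h); rewrite !inE => /eqP.
case: (cS [set v]).
- by apply/hclosedP => h; rewrite xE.
- by move/setP/(_ v); rewrite !inE eqxx.
by rewrite -cardsT => <-; rewrite cards1.
Qed.

End Edges.

Lemma conn_sum_parity (R : comNzRingType) (W : nat -> R) p q n :
  (forall k, q <> 2 * k + n)%N -> conn_sum W p q n = 0.
Proof.
move=> nk; apply: big1 => x /and3P[fK _ /eqP lx].
by case: (nk #|hedges x|); rewrite -lx -(card_flags fK) card_ord.
Qed.

(** A graph with k edges and more than k + 1 vertices is not connected.  With
    all weights equal to 1, [cut_recursion] proves it by induction on k: if it
    holds for the graphs with fewer edges, every term on the right vanishes. *)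
Lemma conn_count_eq0 p k n : (k.+1 < p)%N ->
  conn_sum (fun=> 1 : int) p (2 * k + n) n = 0.
Proof.
elim/ltn_ind: k p n => k IH p n kp.
case: k IH kp => [|k] IH kp.
  rewrite muln0 add0n; apply: big1 => x /and3P[fK cx /eqP lx].
  have := hconn_noedge (_ : #|hlegs x| = #|'I_n|) cx.
  by rewrite lx !card_ord => /(_ erefl) p1; rewrite p1 in kp.
have := cut_recursion (fun=> 1 : int) p (2 * k.+1 + n) n.
rewrite [in X in _ = X + _](_ : 2 * k.+1 + n = 2 * k + n.+2)%N; last by lia.
rewrite (IH k) ?(ltnW kp) // mulr0 add0r big1 => [|p1 _].
  move/eqP; rewrite mulf_eq0 natrD addrK => /orP[|/eqP //].
  by rewrite pnatr_eq0.
rewrite big1 // => q1 _; rewrite big1 ?mulr0 // => n1 _.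
(* k1 and k2 are the numbers of edges of the two components *)
case: (boolP [exists k1 : 'I_(2 * k.+1 + n).+1, q1 == 2 * k1 + n1 :> nat]%N); last first.
  rewrite negb_exists => /forallP nk; rewrite conn_sum_parity ?mul0r ?mulr0 // => k1 E.
  have lk : (k1 < (2 * k.+1 + n).+1)%N by have := ltn_ord q1; rewrite E; lia.
  by have := nk (Ordinal lk); rewrite /= E eqxx.
case/existsP => -[k1 /= _] /eqP q1E.
case: (boolP [exists k2 : 'I_(2 * k.+1 + n).+1, (2 * k.+1 + n) - q1 == 2 * k2 + (n.+2 - n1) :> nat]%N); last first.
  rewrite negb_exists => /forallP nk; rewrite (@conn_sum_parity _ _ (p - p1)) ?mulr0 // => k2 E.
  have lk : (k2 < (2 * k.+1 + n).+1)%N by have := ltn_ord q1; move: E; lia.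
  by have := nk (Ordinal lk); rewrite /= E eqxx.
case/existsP => -[k2 /= _] /eqP q2E.
have := ltn_ord n1; have := ltn_ord q1; have := ltn_ord p1 => lp1 lq1 ln1.
case: (ltnP k1.+1 p1) => kp1; first by rewrite q1E (IH k1) ?mul0r ?mulr0 //; lia.
by rewrite q2E (IH k2) ?mulr0 //; lia.
Qed.

Lemma hconn_edges p q (x : hgraph 'I_p 'I_q) : flipK x -> hconn x ->
  (p <= #|hedges x|.+1)%N.
Proof.
move=> fK cx; rewrite leqNgt; apply/negP => /(conn_count_eq0 #|hlegs x|).
rewrite -(card_flags fK) card_ord /conn_sum => /eqP.
rewrite psumr_eq0 => [|y _]; last by rewrite /hweight prodr_ge0.
move=> /allP/(_ x); rewrite mem_index_enum fK cx eqxx => /(_ isT) /=.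
by rewrite /hweight big1.
Qed.

(** So the exponent k + 1 - p of z below, where the subtraction of natural
    numbers is truncated, is exact whenever it matters. *)
Lemma conn_sum_eq0 (R : comNzRingType) (W : nat -> R) p k n : (k.+1 < p)%N ->
  conn_sum W p (2 * k + n) n = 0.
Proof.
move=> kp; apply: big1 => x /and3P[fK cx /eqP lx].
have := hconn_edges fK cx; have := card_flags fK; rewrite card_ord lx; lia.
Qed.

Lemma conn_sum0 (R : comNzRingType) (W : nat -> R) q n : conn_sum W 0 q n = 0.
Proof.
apply: big1 => x /and3P[_ /hconnP[/set0Pn[v]]]; by case: v.
Qed.

(** * Keeping track of the genus *)
Section Series.
Variable W : nat -> {poly rat}.

(** The sum over isomorphism classes weighted by 1/|Aut|, by orbit counting. *)
Definition conn_mass (p k n : nat) : {poly rat} :=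
  (p`! * (2 * k + n)`!)%:R^-1 *: conn_sum W p (2 * k + n) n.

Lemma conn_mass_small p k n : (k.+1 < p)%N -> conn_mass p k n = 0.
Proof. by move=> kp; rewrite /conn_mass conn_sum_eq0 // scaler0. Qed.

Lemma sum_progression (R : nmodType) (F : nat -> R) m k n1 :
  (forall q1, (q1 < m)%N -> (forall k1, (k1 < k)%N -> q1 <> 2 * k1 + n1)%N -> F q1 = 0) ->
  (forall k1, k1 < k -> 2 * k1 + n1 < m)%N ->
  \sum_(q1 < m) F q1 = \sum_(k1 < k) F (2 * k1 + n1)%N.
Proof.
move=> F0 km.
transitivity (\sum_(k1 < k) \sum_(q1 < m | q1 == (2 * k1 + n1)%N :> nat) F q1).
  rewrite (exchange_big_dep predT) //=; apply: eq_bigr => q1 _.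
  case: (boolP [exists k1 : 'I_k, q1 == 2 * k1 + n1 :> nat]%N) => [/existsP[k1 /eqP k1E]|].
    rewrite (big_pred1 k1) // => k2 /=; rewrite -val_eqE /= k1E; apply/eqP/eqP; lia.
  rewrite negb_exists => /forallP nk; rewrite big_pred0 => [|k1]; last exact: negbTE.
  by apply: F0 => // k1 k1k /eqP; apply/negP; apply: (nk (Ordinal k1k)).
apply: eq_bigr => k1 _; rewrite (big_pred1 (Ordinal (km k1 (ltn_ord k1)))) //.
Qed.

(** The binomial coefficients of [cut_recursion] are absorbed by the
    factorials; the number q1 of half-edges of the first component is
    2 * k1 + n1 for its numbers k1 of edges and n1 of legs. *)
Lemma conn_mass_recursion p k n :
  (2 * k.+1)%:R * conn_mass p k.+1 n =
  (n.+2 * n.+1)%:R * conn_mass p k n.+2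
  + \sum_(p1 < p.+1) \sum_(k1 < k.+1) \sum_(n1 < n.+3) (n1 * (n.+2 - n1))%:R
       * (conn_mass p1 k1 n1 * conn_mass (p - p1) (k - k1) (n.+2 - n1)).
Proof.
have qE : (2 * k.+1 + n = 2 * k + n.+2)%N by lia.
have := cut_recursion W p (2 * k.+1 + n) n.
rewrite [in X in X * _](natrD _ (2 * k.+1)) addrK.
move/(congr1 (fun P => (p`! * (2 * k.+1 + n)`!)%:R^-1 *: P)).
rewrite scalerAr -/(conn_mass p k.+1 n) => ->.
rewrite scalerDr {1 2}qE scalerAr -/(conn_mass p k n.+2); congr (_ + _).
rewrite scaler_sumr; apply: eq_bigr => p1 _; rewrite scaler_sumr.
transitivity (\sum_(n1 < n.+3) \sum_(q1 < (2 * k.+1 + n).+1)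
  (n1 * (n.+2 - n1))%:R *
   (((p1`! * q1`!)%:R^-1 *: conn_sum W p1 q1 n1) *
    (((p - p1)`! * (2 * k.+1 + n - q1)`!)%:R^-1 *:
       conn_sum W (p - p1) (2 * k.+1 + n - q1) (n.+2 - n1)))).
  rewrite exchange_big /=; apply: eq_bigr => q1 _.
  rewrite mulr_sumr scaler_sumr; apply: eq_bigr => n1 _.
  rewrite mulrCA scalerAr; congr (_ * _).
  rewrite -scalerAl -scalerAr mulr_natl -scaler_nat !scalerA; congr (_ *: _).
  have bp := bin_fact (_ : p1 <= p)%N; have bq := bin_fact (_ : q1 <= 2 * k.+1 + n)%N.
  rewrite -bp -?bq; try by rewrite -ltnS.
  rewrite !natrM; have f0 m : (m`!)%:R != 0 :> rat by rewrite pnatr_eq0 -lt0n fact_gt0.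
  have c0 m m' : (m' < m.+1)%N -> 'C(m, m')%:R != 0 :> rat.
    by rewrite ltnS => lm; rewrite pnatr_eq0 -lt0n bin_gt0.
  have := c0 _ _ (ltn_ord p1); have := c0 _ _ (ltn_ord q1).
  have := f0 p1; have := f0 q1; have := f0 (p - p1)%N; have := f0 (2 * k.+1 + n - q1)%N.
  move: (p1`!)%:R (q1`!)%:R ((p - p1)`!)%:R ((2 * k.+1 + n - q1)`!)%:R.
  move: ('C(p, p1))%:R ('C(_, q1))%:R => c1 c2 f1 f2 f3 f4 h1 h2 h3 h4 h5 h6.
  by field; rewrite h1 h2 h3 h4 h5 h6.
rewrite [RHS]exchange_big /=; apply: eq_bigr => n1 _.
pose F q1 := (n1 * (n.+2 - n1))%:R *
   (((p1`! * q1`!)%:R^-1 *: conn_sum W p1 q1 n1) *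
    (((p - p1)`! * (2 * k.+1 + n - q1)`!)%:R^-1 *:
       conn_sum W (p - p1) (2 * k.+1 + n - q1) (n.+2 - n1))).
rewrite (@sum_progression _ F _ k.+1 n1) {}/F.
- apply: eq_bigr => k1 _; rewrite /conn_mass.
  have := ltn_ord k1; have := ltn_ord n1 => ln1 lk1.
  by rewrite (_ : 2 * k.+1 + n - (2 * k1 + n1) = 2 * (k - k1) + (n.+2 - n1))%N; last by lia.
- move=> q1 lq1 nk.
  case: (boolP [exists k1 : 'I_(2 * k.+1 + n).+1, q1 == 2 * k1 + n1 :> nat]%N); last first.
    rewrite negb_exists => /forallP nk1; rewrite conn_sum_parity ?scaler0 ?mul0r ?mulr0 // => k1 E.
    have lk : (k1 < (2 * k.+1 + n).+1)%N by move: lq1; rewrite E; lia.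
    by have := nk1 (Ordinal lk); rewrite /= E eqxx.
  case/existsP => -[k1 /= _] /eqP q1E.
  rewrite (@conn_sum_parity _ _ (p - p1)) ?scaler0 ?mulr0 // => k2 E.
  have := ltn_ord n1 => ln1.
  by apply: (nk k1); lia.
- by move=> k1 lk1; have := ltn_ord n1; lia.
Qed.

(** The factor 'X^(k + 1 - p) is z to the power of the first Betti number, so
    if W n is the generating polynomial of vertices by genus, the coefficient of
    z^g collects the graphs of genus g. *)
Definition genus_poly (k n : nat) : {poly rat} :=
  \sum_(p < k.+2) 'X^(k.+1 - p) * conn_mass p k n.

(** Reversal of coefficients is multiplicative: z^m1 A(1/z) and z^m2 B(1/z)
    multiply to z^(m1 + m2) (A B)(1/z). *)
Lemma prod_top_degree (a b : nat -> {poly rat}) m1 m2 :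
  (forall i, (m1 < i)%N -> a i = 0) -> (forall j, (m2 < j)%N -> b j = 0) ->
  \sum_(p < (m1 + m2).+1) 'X^(m1 + m2 - p) * (\sum_(i < p.+1) a i * b (p - i)%N) =
  (\sum_(i < m1.+1) 'X^(m1 - i) * a i) * (\sum_(j < m2.+1) 'X^(m2 - j) * b j).
Proof.
move=> a0 b0; set N := (m1 + m2)%N.
have wid m (c : nat -> {poly rat}) : (m <= N)%N -> (forall i, (m < i)%N -> c i = 0) ->
    \sum_(i < m.+1) 'X^(m - i) * c i = \sum_(i < N.+1) 'X^(m - i) * c i.
  move=> mN c0; rewrite (big_ord_widen N.+1 (fun i => 'X^(m - i) * c i)) //.
  rewrite big_mkcond; apply: eq_bigr => i _; case: ifP => // /negbT.
  by rewrite -leqNgt => mi; rewrite c0 ?mulr0.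
rewrite !wid ?leq_addr ?leq_addl // mulr_suml.
under [RHS]eq_bigr do rewrite mulr_sumr.
rewrite [RHS]pair_bigA /=.
transitivity (\sum_(p < N.+1) \sum_(u : 'I_N.+1 * 'I_N.+1 | (u.1 + u.2 == p)%N)
   'X^(m1 - u.1) * a u.1 * ('X^(m2 - u.2) * b u.2)).
  apply: eq_bigr => p _; rewrite mulr_sumr.
  have lp i : (i < p.+1 -> i < N.+1)%N by have := ltn_ord p; lia.
  rewrite (reindex_onto (fun i : 'I_p.+1 => (widen_ord (ltn_ord p) i, inord (p - i) : 'I_N.+1))
     (fun u => inord u.1 : 'I_p.+1)) /=; last first.
    move=> [i j] /= /eqP ij; have lip : (i < p.+1)%N by rewrite -ij; lia.
    congr (_, _); apply: val_inj; rewrite /= !inordK //; first by rewrite -ij addKn.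
    by have := ltn_ord p; lia.
  apply: eq_big => [i|i _] /=.
    have := ltn_ord i; have := ltn_ord p => lpN li.
    rewrite inordK; last by lia.
    rewrite subnKC ?eqxx //=; apply/esym/eqP; apply: val_inj; by rewrite /= inordK.
  have := ltn_ord i; have := ltn_ord p => lpN li.
  rewrite inordK; last by lia.
  case: (ltnP m1 i) => mi; first by rewrite a0 // !(mul0r, mulr0).
  case: (ltnP m2 (p - i)) => mi2; first by rewrite b0 // !(mul0r, mulr0).
  rewrite (_ : N - p = (m1 - i) + (m2 - (p - i)))%N; last first.
    by have : N = (m1 + m2)%N := erefl; lia.
  by rewrite exprD; ring.
rewrite (exchange_big_dep predT) //=; apply: eq_bigr => -[i j] _ /=.
case: (ltnP N (i + j)) => ij.
  rewrite big_pred0 => [|p]; last by have := ltn_ord p; lia.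
  case: (ltnP m1 i) => mi; first by rewrite a0 // !(mul0r, mulr0).
  by rewrite b0 ?mulr0 //; have : N = (m1 + m2)%N := erefl; lia.
by rewrite (big_pred1 (Ordinal (ij : i + j < N.+1)%N)) // => p; rewrite -val_eqE eq_sym.
Qed.

(** A cut that leaves the graph connected lowers the Betti number by one, hence
    the factor 'X; in the other case Betti numbers add up. *)
Lemma genus_poly_recursion k n :
  (2 * k.+1)%:R * genus_poly k.+1 n =
  'X * ((n.+2 * n.+1)%:R * genus_poly k n.+2)
  + \sum_(k1 < k.+1) \sum_(n1 < n.+3) (n1 * (n.+2 - n1))%:R
       * (genus_poly k1 n1 * genus_poly (k - k1) (n.+2 - n1)).
Proof.
rewrite /genus_poly [LHS]mulr_sumr.
under eq_bigr do rewrite mulrCA conn_mass_recursion mulrDr.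
rewrite big_split /=; congr (_ + _).
  rewrite big_ord_recr /= conn_mass_small // !mulr0 addr0 !mulr_sumr.
  apply: eq_bigr => p _; rewrite (_ : k.+2 - p = (k.+1 - p).+1)%N ?exprS.
    by ring.
  by have := ltn_ord p; lia.
transitivity (\sum_(k1 < k.+1) \sum_(n1 < n.+3) (n1 * (n.+2 - n1))%:R *
   \sum_(p < k.+3) 'X^(k.+2 - p) * \sum_(p1 < p.+1)
       (conn_mass p1 k1 n1 * conn_mass (p - p1) (k - k1) (n.+2 - n1))).
  under [RHS]eq_bigr do under eq_bigr do rewrite mulr_sumr.
  under [RHS]eq_bigr do rewrite exchange_big /=.
  rewrite [RHS]exchange_big /=; apply: eq_bigr => p _.
  rewrite exchange_big /= mulr_sumr; apply: eq_bigr => k1 _.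
  rewrite exchange_big /= mulr_sumr; apply: eq_bigr => n1 _.
  by rewrite mulrCA -mulr_sumr.
apply: eq_bigr => k1 _; apply: eq_bigr => n1 _; congr (_ * _).
have -> : (k.+2 = k1.+1 + (k - k1).+1)%N by have := ltn_ord k1; lia.
rewrite (@prod_top_degree (fun p1 => conn_mass p1 k1 n1)
  (fun p2 => conn_mass p2 (k - k1) (n.+2 - n1))) // => p kp; exact: conn_mass_small.
Qed.

End Series.

(** * Isomorphism classes of stable graphs *)
Local Open Scope quotient_scope.

Definition hgraph_of (G : graph) : hgraph 'I_(nv G) 'I_(nh G) := (Defs.root G, Defs.flip G).

Lemma hgraph_of_flipK G : flipK (hgraph_of G).
Proof. exact: (flip_inv G). Qed.

Lemma connected_graphE G : connected_graph G = hconn (hgraph_of G).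
Proof.
have fK : involutive (Defs.flip G) := flipKP _ (hgraph_of_flipK G).
have adj u v : reflect (exists h, Defs.root G h = u /\ Defs.root G (Defs.flip G h) = v) (adjacent u v).
  apply: (iffP existsP) => [[h /andP[/eqP ? /eqP ?]]|[h [<- <-]]]; exists h => //.
  by rewrite !eqxx.
have sym : connect_sym (@adjacent G).
  apply: sym_connect_sym => u v; apply/adj/adj => -[h [<- <-]];
    by exists (Defs.flip G h); rewrite fK.
have clos (S : {set 'I_(nv G)}) : hclosed (hgraph_of G) S -> closed (@adjacent G) S.
  by move/hclosedP=> cS u v /adj[h [<- <-]]; apply: cS.
apply/eqP/hconnP => [n1|[/set0Pn[v _] cT]].
  have /card_gt0P[r /andP[/= _ _]] : (0 < num_components G)%N by rewrite n1.
  split; first by apply/set0Pn; exists r; rewrite inE.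
  move=> S /clos cS; have [->|/set0Pn[v vS]] := eqVneq S set0; [by left|right].
  apply/setP => u; rewrite inE -(closed_connect cS (_ : connect _ v u)) //.
  apply/(fingraph.rootP sym); have : (num_components G <= 1)%N by rewrite n1.
  move/card_le1_eqP; apply; by rewrite inE /= ?(roots_root sym).
pose S := [set u | connect (@adjacent G) v u].
have cS : hclosed (hgraph_of G) S.
  apply/hclosedP => h; rewrite !inE; apply: same_connect_r => //.
  by apply/connect1/adj; exists h.
have ST : S = setT.
  case: (cT S cS) => // /setP/(_ v); rewrite !inE connect0 //.
rewrite /num_components -(n_comp_connect sym v); apply: eq_n_comp_r => u.
by have := in_setT u; rewrite -ST !inE => ->.
Qed.

Lemma card_edges G : nh G = (2 * #|edges G| + #|legs G|)%N.
Proof. by rewrite -[LHS]card_ord (card_flags (hgraph_of_flipK G)). Qed.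

Definition graph_weight (G : graph) : rat := \prod_v chi_M (gen G v) (valence v).

(** The last equation is genus G = g for a connected graph, written without
    subtraction. *)
Definition in_stratum g n k p (G : graph) :=
  [&& connected_graph G, stable_graph G, #|legs G| == n, #|edges G| == k, nv G == p
    & (k.+1 + \sum_v gen G v == g + p)%N].

Section Isomorphism.
Variables (G1 G2 : graph) (f : graph_map G1 G2).
Hypothesis iso : is_iso f.

Lemma iso_bijv : bijective f.1.
Proof. by case/and5P: iso => /bijectivebP. Qed.

Lemma iso_bijh : bijective f.2.
Proof. by case/and5P: iso => _ /bijectivebP. Qed.

Lemma iso_gen v : gen G2 (f.1 v) = gen G1 v.
Proof. by case/and5P: iso => _ _ _ _ /forallP/(_ v)/eqP. Qed.

Lemma iso_embedding : embedding f.1 f.2 (hgraph_of G1) (hgraph_of G2).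
Proof.
case/and5P: iso => _ _ /forallP fr /forallP ff _; split.
- exact: bij_inj iso_bijv.
- exact: bij_inj iso_bijh.
- by move=> h; apply/eqP/fr.
- by move=> h; apply/eqP/ff.
- by case: iso_bijh => g _ gK h v _; exists (g h); rewrite gK.
Qed.

Lemma iso_valence v : valence (f.1 v) = valence v.
Proof. exact: emb_val iso_embedding v. Qed.

Let imT : f.1 @: setT = setT.
Proof.
case: iso_bijv => g _ gK; apply/setP => v; rewrite [RHS]inE; apply/imsetP.
by exists (g v); rewrite ?gK.
Qed.

Lemma iso_nv : nv G2 = nv G1.
Proof. by rewrite -(card_ord (nv G1)) -(card_ord (nv G2)) (bij_eq_card iso_bijv). Qed.

Lemma iso_nh : nh G2 = nh G1.
Proof. by rewrite -(card_ord (nh G1)) -(card_ord (nh G2)) (bij_eq_card iso_bijh). Qed.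

Lemma iso_legs : #|legs G2| = #|legs G1|.
Proof.
by rewrite -(emb_card_legs iso_embedding) imT preimsetT setIT.
Qed.

Lemma iso_edges : #|edges G2| = #|edges G1|.
Proof. have := iso_nh; have := iso_legs; have := card_edges G1; have := card_edges G2; lia. Qed.

Lemma iso_stratum g n k p : in_stratum g n k p G2 = in_stratum g n k p G1.
Proof.
rewrite /in_stratum iso_legs iso_edges; congr [&& _, _, _, _, _ & _].
- by rewrite !connected_graphE -(emb_comp iso_embedding (hgraph_of_flipK G2)) imT.
- have [fi ifK fiK] := iso_bijv.
  apply/forallP/forallP => st v; first by rewrite -iso_gen -iso_valence.
  by rewrite -(fiK v) iso_gen iso_valence.
- by rewrite iso_nv.
- congr (_ + _ == _)%N.
  by rewrite (reindex f.1) /=; [|exact: onW_bij iso_bijv]; apply: eq_bigr => v _; rewrite iso_gen.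
Qed.

Lemma iso_weight : graph_weight G2 = graph_weight G1.
Proof.
rewrite /graph_weight (reindex f.1) /=; last exact: onW_bij iso_bijv.
by apply: eq_bigr => v _; rewrite iso_gen iso_valence.
Qed.

Lemma iso_compose (a : graph_map G1 G1) :
  is_iso a -> is_iso (([ffun v => f.1 (a.1 v)], [ffun h => f.2 (a.2 h)]) : graph_map G1 G2).
Proof.
case/and5P: iso => /bijectivebP f1 /bijectivebP f2 /forallP fr /forallP ff /forallP fg.
case/and5P => /bijectivebP k1 /bijectivebP k2 /forallP kr /forallP kf /forallP kg.
apply/and5P; split; [apply/bijectivebP|apply/bijectivebP|..].
- by apply: (eq_bij (bij_comp f1 k1)) => v; rewrite ffunE.
- by apply: (eq_bij (bij_comp f2 k2)) => h; rewrite ffunE.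
- by apply/forallP => h; rewrite !ffunE (eqP (fr _)) (eqP (kr _)).
- by apply/forallP => h; rewrite !ffunE (eqP (ff _)) (eqP (kf _)).
- by apply/forallP => v; rewrite !ffunE (eqP (fg _)) (eqP (kg _)).
Qed.

(** The isomorphisms form a torsor under Aut G1. *)
Lemma card_iso : #|[set k : graph_map G1 G2 | is_iso k]| = #|graph_Aut G1|.
Proof.
pose c (a : graph_map G1 G1) : graph_map G1 G2 :=
  ([ffun v => f.1 (a.1 v)], [ffun h => f.2 (a.2 h)]).
have c_inj : injective c.
  move=> [a b] [a' b'] [/ffunP E1 /ffunP E2]; congr (_, _); apply/ffunP => z.
    by apply: (bij_inj iso_bijv); have := E1 z; rewrite !ffunE.
  by apply: (bij_inj iso_bijh); have := E2 z; rewrite !ffunE.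
rewrite -(card_imset _ c_inj); apply: eq_card => k; rewrite inE.
apply/idP/imsetP => [ik|[a]]; last by rewrite inE => ia ->; apply: iso_compose.
have [f1 f1K f1K'] := iso_bijv; have [f2 f2K f2K'] := iso_bijh.
exists ([ffun v => f1 (k.1 v)], [ffun h => f2 (k.2 h)]); last first.
  by case: k {ik} => k1 k2; congr (_, _); apply/ffunP => z; rewrite !ffunE ?f1K' ?f2K'.
case/and5P: ik => /bijectivebP k1 /bijectivebP k2 /forallP kr /forallP kf /forallP kg.
case/and5P: iso => _ _ /forallP fr /forallP ff /forallP fg.
rewrite inE; apply/and5P; split; [apply/bijectivebP|apply/bijectivebP|..].
- by apply: (eq_bij (bij_comp (Bijective f1K' f1K) k1)) => v; rewrite ffunE.
- by apply: (eq_bij (bij_comp (Bijective f2K' f2K) k2)) => h; rewrite ffunE.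
- apply/forallP => h; rewrite !ffunE /=; apply/eqP/(can_inj f1K).
  by rewrite f1K' -(eqP (fr _)) f2K' (eqP (kr _)).
- apply/forallP => h; rewrite !ffunE /=; apply/eqP/(can_inj f2K).
  by rewrite f2K' -(eqP (ff _)) f2K' (eqP (kf _)).
- by apply/forallP => v; rewrite !ffunE -(eqP (fg _)) f1K' (eqP (kg _)).
Qed.

End Isomorphism.

(** Graphs on labelled vertices and half-edges; bounding the genera of the
    vertices by B makes them a finite type. *)
Definition lgraph (B p q : nat) : predArgType :=
  {y in [pred y : hgraph 'I_p 'I_q * {ffun 'I_p -> 'I_B.+1} | flipK y.1]}.
HB.instance Definition _ B p q := SubFinite.on (lgraph B p q).

Definition graph_of B p q (u : lgraph B p q) : graph :=
  @Graph p q (val u).1.1 (val u).1.2 [ffun v => (val u).2 v : nat] (valP u).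

Lemma card_bijectiveb (A1 A2 : finType) : #|A1| = #|A2| ->
  #|[set f : {ffun A1 -> A2} | bijectiveb f]| = (#|A1|`!)%N.
Proof.
move=> A12; rewrite -ffactnn {1}A12 -card_inj_ffuns; apply: eq_card => f.
rewrite !inE; apply/bijectivebP/injectiveP => [|fi]; first exact: bij_inj.
by apply: inj_card_bij; rewrite ?A12.
Qed.

(** Both sides count the isomorphisms from G to labelled graphs: a labelled
    graph isomorphic to G is the target of |Aut G| of them, and each pair of
    bijections is an isomorphism to exactly one labelled graph. *)
Lemma card_labellings B p q (G : graph) :
  nv G = p -> nh G = q -> (forall v, gen G v <= B)%N ->
  (#|[set u : lgraph B p q | isomorphic G (graph_of u)]| * #|graph_Aut G| = p`! * q`!)%N.
Proof.
move=> nvG nhG gB.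
transitivity (\sum_(u : lgraph B p q) #|[set f : graph_map G (graph_of u) | is_iso f]|)%N.
  (* the isomorphisms to a fixed target *)
  rewrite -sum_nat_const [LHS]big_mkcond; apply: eq_bigr => u _; rewrite inE.
  case: ifP => [/existsP[f fi]|/negbT]; first by rewrite (card_iso fi).
  rewrite negb_exists => /forallP nf; apply/esym/eqP; rewrite cards_eq0.
  by apply/eqP/setP => f; rewrite !inE (negPf (nf f)).
pose F := ({ffun 'I_(nv G) -> 'I_p} * {ffun 'I_(nh G) -> 'I_q})%type.
transitivity (\sum_(f : F) \sum_(u : lgraph B p q) is_iso (f : graph_map G (graph_of u)))%N.
  rewrite [RHS]exchange_big /=; apply: eq_bigr => u _.
  by rewrite -sum1dep_card big_mkcond.
transitivity (\sum_(f : F) (bijectiveb f.1 && bijectiveb f.2 : nat))%N.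
  apply: eq_bigr => -[f1 f2] _ /=; case: (boolP (bijectiveb f1 && bijectiveb f2)) => [/andP[b1 b2]|nb].
    have [g1 g1K g1K'] := bijectivebP _ b1; have [g2 g2K g2K'] := bijectivebP _ b2.
    (* the structure of G transported along the bijections *)
    pose y : hgraph 'I_p 'I_q * {ffun 'I_p -> 'I_B.+1} :=
      (([ffun h => f1 (Defs.root G (g2 h))], [ffun h => f2 (Defs.flip G (g2 h))]),
       [ffun v => inord (gen G (g1 v))]).
    have fKG : involutive (Defs.flip G) := flipKP _ (hgraph_of_flipK G).
    have yK : y \in [pred y : hgraph 'I_p 'I_q * {ffun 'I_p -> 'I_B.+1} | flipK y.1].
      by rewrite inE; apply/flipKP => h; rewrite /= !ffunE g2K fKG g2K'.
    rewrite (bigD1 (exist _ y yK : lgraph B p q)) //= big1 => [|u uy].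
      apply/eqP; rewrite addn0 eqb1; apply/and5P; split=> //=.
      - by apply/forallP => h; rewrite !ffunE g2K.
      - by apply/forallP => h; rewrite !ffunE g2K.
      - by apply/forallP => v; rewrite !ffunE g1K inordK // ltnS.
    apply/eqP; rewrite eqb0; apply: contra uy => /and5P[_ _ /forallP ur /forallP uf /forallP ug].
    apply/eqP/val_inj => /=; case: u ur uf ug => -[[r f] c] /= _ ur uf ug.
    rewrite /y; congr (_, _, _); apply/ffunP => z; rewrite !ffunE.
    - by rewrite -(eqP (ur _)) /= g2K'.
    - by rewrite -(eqP (uf _)) /= g2K'.
    - by have /eqP := ug (g1 z); rewrite /= ffunE g1K' => <-; rewrite inord_val.
  rewrite big1 // => u _; apply/eqP; rewrite eqb0; apply: contra nb.
  by case/and5P => -> ->.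
transitivity (#|[set f : {ffun 'I_(nv G) -> 'I_p} | bijectiveb f]|
   * #|[set f : {ffun 'I_(nh G) -> 'I_q} | bijectiveb f]|)%N.
  rewrite -!sum1dep_card big_distrl /=.
  under [RHS]eq_bigr do rewrite mul1n.
  rewrite pair_big /= [RHS]big_mkcond; apply: eq_bigr => f _.
  by case: ifP.
by rewrite !card_bijectiveb ?card_ord ?nvG ?nhG.
Qed.

(** The value 0 at unstable vertices turns the stability condition into a
    property of weights, for which edge cutting needs no case distinction. *)
Definition stable_weight (g n : nat) : rat :=
  if (2 < 2 * g + n)%N then chi_M g n else 0.

Definition vertex_poly (B n : nat) : {poly rat} := \poly_(i < B.+1) stable_weight i n.

Lemma coef_hweight B (V H : finType) (x : hgraph V H) s :
  (hweight (vertex_poly B) x)`_s =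
  \sum_(c : {ffun V -> 'I_B.+1} | (\sum_v c v == s)%N)
     \prod_v stable_weight (c v) (hvalence x v).
Proof.
rewrite /hweight; under eq_bigr do rewrite /vertex_poly poly_def.
rewrite (bigA_distr_bigA (fun v (i : 'I_B.+1) => stable_weight i (hvalence x v) *: 'X^i)) /=.
under eq_bigr do rewrite scaler_prod prodrXr.
by rewrite coef_sumMXn.
Qed.

Lemma sum_lgraph B g n k p s : (k.+1 + s = g + p)%N ->
  \sum_(u : lgraph B p (2 * k + n) | in_stratum g n k p (graph_of u))
     graph_weight (graph_of u) =
  (conn_sum (vertex_poly B) p (2 * k + n) n)`_s.
Proof.
move=> sE; rewrite /conn_sum coef_sum.
under [RHS]eq_bigr do rewrite coef_hweight.
rewrite pair_big_dep /=.
transitivity (\sum_(y in [pred y : hgraph 'I_p 'I_(2 * k + n) * {ffun 'I_p -> 'I_B.+1} | flipK y.1]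
   | [&& hconn y.1, #|hlegs y.1| == n & (\sum_v y.2 v == s)%N])
   \prod_v stable_weight (y.2 v) (hvalence y.1 v)); last first.
  by apply: eq_bigl => y; rewrite inE -!andbA.
rewrite [RHS]big_sub_cond big_mkcond [RHS]big_mkcond; apply: eq_bigr => u _.
rewrite /in_stratum connected_graphE.
case: u => -[[r f] c] fK /=.
rewrite -[hgraph_of _]/((r, f) : hgraph _ _) -[legs _]/(hlegs ((r, f) : hgraph _ _)).
rewrite -[edges _]/(hedges ((r, f) : hgraph _ _)) eqxx.
case: (boolP (hconn _)) => //= cx; case: eqP => /= ln; last by rewrite andbF.
have -> : #|hedges ((r, f) : hgraph _ _)| == k.
  have := @card_flags _ _ ((r, f) : hgraph _ _) fK; rewrite card_ord ln => qE.
  by apply/eqP; lia.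
have -> : (k.+1 + \sum_v gen (graph_of (exist _ (r, f, c) fK : lgraph B p (2 * k + n))) v == g + p)%N
   = (\sum_v c v == s)%N.
  rewrite -sE eqn_add2l; congr (_ == _).
  by apply: eq_bigr => v _; rewrite /= ffunE.
case: eqP => //= cs; rewrite ?andbF ?andbT //.
case: ifP => [/forallP st|/negbT].
  apply: eq_bigr => v _; rewrite /stable_weight; have := st v.
  by rewrite /= ffunE => ->.
rewrite negb_forall => /existsP[v nst]; rewrite (bigD1 v) //= /stable_weight.
by move: nst; rewrite /= ffunE => /negPf ->; rewrite mul0r.
Qed.

Lemma chi_tilde_seq g n : exists s : seq iso_class, [/\ uniq s,
   forall C, (C \in s) <-> Gc g n C &
   chi_tilde g n = \sum_(C <- s)
     (#|graph_Aut (repr C)|%:R^-1 * graph_weight (repr C)) *: 'X^#|edges (repr C)|].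
Proof.
have fin := finite_Gc g n.
exists (finmap.enum_fset (cardinality.fset_set (Gc g n))); split.
- exact: finmap.fset_uniq.
- move=> C; rewrite [_ \in _]cardinality.in_fset_set //; split.
    by move/classical_sets.set_mem.
  by move=> GC; apply/classical_sets.mem_set.
- by rewrite /chi_tilde fsbigop.fsbig_finite.
Qed.

Lemma genus_connected G g : connected_graph G ->
  genus G = g%:Z <-> (#|edges G|.+1 + \sum_v gen G v = g + nv G)%N.
Proof. by move=> /eqP cG; rewrite /genus /h1 cG; split; lia. Qed.

Lemma Gc_stratum g n (C : iso_class) : Gc g n C <->
  exists k p, in_stratum g n k p (repr C).
Proof.
rewrite /Gc /=; split=> [[cG sG gG lG]|[k [p' /and5P[cG sG /eqP lG /eqP kG /andP[/eqP pG /eqP gG]]]]].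
  exists #|edges (repr C)|, (nv (repr C)); rewrite /in_stratum cG sG lG !eqxx /=.
  exact/eqP/(genus_connected _ cG).
by split=> //; apply/(genus_connected _ cG); rewrite kG gG pG.
Qed.

Lemma stratum_bound g n k p G : in_stratum g n k p G -> (p <= k.+1 <= g + p)%N.
Proof.
case/and5P=> cG _ _ /eqP kG /andP[/eqP pG /eqP gG]; rewrite connected_graphE in cG.
by have := hconn_edges (hgraph_of_flipK G) cG; rewrite -[hedges _]/(edges G) kG pG; lia.
Qed.

(** Grouping labelled graphs by isomorphism class. *)
Lemma sum_iso_classes (B g n k p : nat) (s : seq iso_class) : uniq s -> (g <= B)%N ->
  (forall C, (C \in s) <-> Gc g n C) ->
  \sum_(C <- s | in_stratum g n k p (repr C))
     (#|graph_Aut (repr C)|%:R^-1 * graph_weight (repr C)) =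
  (p`! * (2 * k + n)`!)%:R^-1 *
  \sum_(u : lgraph B p (2 * k + n) | in_stratum g n k p (graph_of u))
     graph_weight (graph_of u).
Proof.
move=> us gB sP.
transitivity ((p`! * (2 * k + n)`!)%:R^-1 *
  \sum_(C <- s | in_stratum g n k p (repr C))
  \sum_(u : lgraph B p (2 * k + n) | isomorphic (repr C) (graph_of u)) graph_weight (graph_of u)).
  rewrite mulr_sumr; apply: eq_bigr => C sC.
  have sb := stratum_bound sC.
  case/and5P: (sC) => _ _ /eqP lG /eqP kG /andP[/eqP pG /eqP gG].
  have nhG : nh (repr C) = (2 * k + n)%N by rewrite card_edges kG lG.
  have gensB v : (gen (repr C) v <= B)%N.
    have : (gen (repr C) v <= \sum_v gen (repr C) v)%N by rewrite (bigD1 v) //= leq_addr.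
    lia.
  rewrite (eq_bigr (fun=> graph_weight (repr C))) => [|u /existsP[f]]; last exact: iso_weight.
  rewrite sumr_const -[X in _ = _ * X]mulr_natl mulrA; congr (_ * _).
  have := card_labellings pG nhG gensB; rewrite cardsE => ab.
  have : (p`! * (2 * k + n)`!)%N != 0%N by rewrite -lt0n muln_gt0 !fact_gt0.
  rewrite -ab natrM muln_eq0 negb_or => /andP[a0 b0].
  by rewrite invfM mulrAC mulVf ?mul1r // pnatr_eq0.
congr (_ * _); rewrite (exchange_big_dep (fun u => in_stratum g n k p (graph_of u))) /=; last first.
  by move=> C u sC /existsP[f fi]; rewrite (iso_stratum fi).
apply: eq_bigr => u su; pose C := \pi_iso_class (graph_of u).
have iC : isomorphic (repr C) (graph_of u) by apply/eqmodP; rewrite reprK.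
have CE C' : isomorphic (repr C') (graph_of u) = (C' == C).
  apply/idP/eqP => [iC'|->//]; rewrite -(reprK C'); apply/eqmodP.
  exact: iC'.
have sC : in_stratum g n k p (repr C).
  by case/existsP: iC => f fi; rewrite -(iso_stratum fi).
have Cs : C \in s by apply/sP/Gc_stratum; exists k, p.
rewrite big_mkcond (bigD1_seq C) //= sC CE eqxx big1 ?addr0 // => C' /negPf C'C.
by rewrite CE C'C andbF.
Qed.

(** Any bound B >= g on the genera of the vertices gives the same
    coefficient, because the Betti number is nonnegative. *)
Theorem coef_chi_tilde B g n k : (g <= B)%N ->
  (chi_tilde g n)`_k = (genus_poly (vertex_poly B) k n)`_g.
Proof.
move=> gB; have [s [us sP ->]] := chi_tilde_seq g n.
rewrite coef_sumMXn /genus_poly coef_sum.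
transitivity (\sum_(p < k.+2) \sum_(C <- s | in_stratum g n k p (repr C))
  (#|graph_Aut (repr C)|%:R^-1 * graph_weight (repr C))).
  rewrite (exchange_big_dep predT) //= big_mkcond big_seq [RHS]big_seq.
  apply: eq_bigr => C /sP/Gc_stratum[k' [p sC]].
  have sb := stratum_bound sC; case/and5P: (sC) => cG sG lG /eqP kG /andP[/eqP pG gG].
  rewrite kG; case: eqP => [k'E|k'k]; last first.
    rewrite big_pred0 // => i; apply/negP => /and5P[_ _ _ /eqP kG' _].
    by apply: k'k; rewrite -kG -kG'.
  have pk : (p < k.+2)%N by rewrite -k'E; case/andP: sb.
  rewrite (big_pred1 (Ordinal pk)) // => i /=; rewrite -val_eqE /=.
  apply/idP/eqP => [/and5P[_ _ _ _ /andP[/eqP <- _]]|->]; last by rewrite -k'E.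
  by rewrite pG.
apply: eq_bigr => p _; rewrite coefXnM.
case: ifP => gp.
  rewrite big_pred0 // => C; apply/negP => /stratum_bound; lia.
rewrite (sum_iso_classes _ _ us gB sP).
rewrite (@sum_lgraph B g n k p (g - (k.+1 - p))); last by have := ltn_ord p; lia.
by rewrite /conn_mass coefZ.
Qed.

(** * The differential equations of the generating series *)

(** [genus_poly_recursion] in genus g.  The factor 2 accounts for the two
    orders of the halves of the cut edge, and there are n1 * (n + 2 - n1)
    choices of the legs to be glued. *)
Lemma chi_tilde_edge_cut g n :
  (chi_tilde g n)^`() *+ 2 =
  (if g is g'.+1 then chi_tilde g' n.+2 else 0) *+ (n.+2 * n.+1) +
  \sum_(n1 < n.+3) (\sum_(a < g.+1) chi_tilde a n1 * chi_tilde (g - a) (n.+2 - n1))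
     *+ (n1 * (n.+2 - n1)).
Proof.
apply/polyP => k; rewrite coefMn coef_deriv -mulrnA.
rewrite (coef_chi_tilde n k.+1 (leqnn g)).
have := congr1 (fun P : {poly rat} => P`_g) (genus_poly_recursion (vertex_poly g) k n).
rewrite mulr_natl coefMn mulnC => ->.
rewrite !coefD coefXM; congr (_ + _).
  case: g => [|g] /=; first by rewrite mul0rn coef0.
  by rewrite mulr_natl !coefMn (coef_chi_tilde n.+2 k (leqnSn g)).
rewrite !coef_sum; under eq_bigr do rewrite coef_sum.
rewrite exchange_big /=; apply: eq_bigr => n1 _.
rewrite coefMn; under eq_bigr do rewrite mulr_natl coefMn.
rewrite sumrMnl coef_sum; congr (_ *+ _).
under eq_bigr do rewrite coefM.
rewrite exchange_big /=; apply: eq_bigr => a _; rewrite coefM.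
apply: eq_bigr => k1 _.
by rewrite (coef_chi_tilde (B := g)) ?(coef_chi_tilde (B := g)) ?leq_subr // -ltnS.
Qed.

Lemma conn_sum_vertex (R : comNzRingType) (W : nat -> R) n :
  conn_sum W 1 n n = W n.
Proof.
pose x : hgraph 'I_1 'I_n := ([ffun=> ord0], [ffun h => h]).
rewrite /conn_sum (big_pred1 x) => [|[r f] /=].
  rewrite /hweight big_ord1 /hvalence -[in RHS](card_ord n); congr W.
  by apply: eq_card => h; rewrite !inE ffunE eqxx.
apply/and3P/eqP => [[_ _ /eqP lE]|->].
  congr (_, _); apply/ffunP => h; rewrite ffunE; first exact: ord1.
  have : hlegs (r, f) == setT by rewrite eqEcard subsetT cardsT lE card_ord leqnn.
  by move/eqP/setP/(_ h); rewrite !inE => /eqP.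
split.
- by apply/flipKP => h; rewrite /= !ffunE.
- apply/hconnP; split; first by apply/set0Pn; exists ord0; rewrite inE.
  move=> S _; case: (boolP (ord0 \in S)) => S0; [right|left]; apply/setP => v.
    by rewrite ord1 S0 inE.
  by rewrite ord1 (negPf S0) inE.
- by rewrite -[X in _ == X]card_ord; apply/eqP/eq_card => h; rewrite !inE ffunE eqxx.
Qed.

(** Without edges there remains the graph with one vertex, whose n legs can be
    permuted. *)
Lemma chi_tilde_init g n : (chi_tilde g n)`_0 = stable_weight g n / (n`!)%:R.
Proof.
rewrite (coef_chi_tilde n 0 (leqnn g)) /genus_poly big_ord_recr big_ord1 /=.
rewrite /conn_mass conn_sum0 scaler0 mulr0 add0r subnn expr0 mul1r muln0 add0n.
by rewrite conn_sum_vertex mul1n coefZ /vertex_poly coef_poly ltnS leqnn mulrC.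
Qed.

(** Sums 2 * g_v + val_v >= 3 over the vertices. *)
Lemma stratum_legs g n k p G : in_stratum g n k p G -> (0 < p)%N && (p.+2 <= 2 * g + n)%N.
Proof.
case/and5P=> cG /forallP sG /eqP lG /eqP kG /andP[/eqP pG /eqP gG].
have p0 : (0 < nv G)%N.
  by rewrite connected_graphE in cG; case/hconnP: cG => /set0Pn[v] _ _; case: v; case: (nv G).
have sumE : (nv G * 3 <= 2 * \sum_v gen G v + nh G)%N.
  rewrite -(sum_valence G) big_distrr /= -big_split /=.
  rewrite -[X in (X * _)%N]card_ord -sum_nat_const.
  by apply: leq_sum => v _; apply: sG.
have := card_edges G; lia.
Qed.

Lemma chi_tilde0_small n : (n < 3)%N -> chi_tilde 0 n = 0.
Proof.
move=> n3; have [s [_ sP ->]] := chi_tilde_seq 0 n.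
rewrite big_seq big1 // => C /sP/Gc_stratum[k [p /stratum_legs]]; lia.
Qed.

Section FpsCalculus.
Local Notation A := (fps {poly rat}).
Local Notation Dy := (@fps_deriv {poly rat}).
Implicit Types f g : A.

Definition fps_kderiv f : A := Fps (fun n => (fcoef f n)^`()).

Lemma fcoefD f g n : fcoef (f + g) n = fcoef f n + fcoef g n.
Proof. by []. Qed.

Lemma fcoefN f n : fcoef (- f) n = - fcoef f n.
Proof. by []. Qed.

Lemma fcoefM f g n : fcoef (f * g) n = \sum_(i < n.+1) fcoef f i * fcoef g (n - i).
Proof. by []. Qed.

Lemma fcoefCM c f n : fcoef (fpsC c * f) n = c * fcoef f n.
Proof.
rewrite fcoefM big_ord_recl /= subn0 big1 ?addr0 // => i _; by rewrite mul0r.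
Qed.

Lemma fcoefXM f n : fcoef (fpsX _ * f) n = if n is m.+1 then fcoef f m else 0.
Proof.
rewrite fcoefM big_ord_recl /= mul0r add0r; case: n => [|n]; first by rewrite big_ord0.
rewrite big_ord_recl /= mul1r subSS subn0 big1 ?addr0 // => i _.
by rewrite mul0r.
Qed.

Lemma fps_derivD f g : Dy (f + g) = Dy f + Dy g.
Proof. by apply: fpsP => n /=; rewrite mulrnDl. Qed.

Lemma fps_derivN f : Dy (- f) = - Dy f.
Proof. by apply: fpsP => n /=; rewrite mulNrn. Qed.

(** The coefficients involved only see truncations of the series, for which this
    is the Leibniz rule of polynomials. *)
Lemma fps_derivM f g : Dy (f * g) = Dy f * g + f * Dy g.
Proof.
apply: fpsP => n.
pose t := @fps_trunc {poly rat} n.+2.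
have tE h i : (i < n.+2)%N -> (t h)`_i = fcoef h i.
  by move=> ni; rewrite coef_poly ni.
transitivity (((t f * t g)^`())`_n).
  rewrite coef_deriv -fcoef_mul_trunc //.
rewrite derivM coefD !coefM fcoefD !fcoefM.
congr (_ + _); apply: eq_bigr => i _; have := ltn_ord i => li.
  by rewrite coef_deriv !tE //; lia.
by rewrite coef_deriv !tE //=; lia.
Qed.

Lemma fps_derivC c : Dy (fpsC c) = 0.
Proof. by apply: fpsP => n /=; rewrite mul0rn if_same. Qed.

Lemma fps_derivX : Dy (fpsX _) = 1.
Proof. by apply: fpsP => -[|n] /=; rewrite ?mulr1n ?mul0rn. Qed.

Lemma fps_kderivD f g : fps_kderiv (f + g) = fps_kderiv f + fps_kderiv g.
Proof. by apply: fpsP => n /=; rewrite derivD. Qed.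

Lemma fps_kderivN f : fps_kderiv (- f) = - fps_kderiv f.
Proof. by apply: fpsP => n /=; rewrite derivN. Qed.

Lemma fps_kderivM f g : fps_kderiv (f * g) = fps_kderiv f * g + f * fps_kderiv g.
Proof.
apply: fpsP => n; rewrite fcoefD !fcoefM /= (big_morph _ (@derivD _) (@deriv0 _)) -big_split /=.
by apply: eq_bigr => i _; rewrite derivM.
Qed.

Lemma fps_kderivC c : fps_kderiv (fpsC c) = fpsC c^`().
Proof. by apply: fpsP => -[|n] //=; rewrite deriv0. Qed.

Lemma fps_kderivX : fps_kderiv (fpsX _) = 0.
Proof. by apply: fpsP => -[|[|n]] /=; rewrite ?derivC // -[1]/(1%:P) derivC. Qed.

Lemma fps_kderiv_deriv f : fps_kderiv (Dy f) = Dy (fps_kderiv f).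
Proof. by apply: fpsP => n /=; rewrite derivMn. Qed.

Lemma fps_double_inj f g : f + f = g + g -> f = g.
Proof.
move=> E; apply: fpsP => n; apply/polyP => m; apply: (@pmulrnI _ 2) => //.
by have := congr1 (fun h : fps {poly rat} => (fcoef h n)`_m) E; rewrite !fcoefD !coefD -!mulr2n.
Qed.

(** A linear evolution equation in kappa has only the zero solution with zero
    initial value: it expresses the coefficient of kappa^(m+1) by those of
    kappa^j with j <= m. *)
Lemma fps_flow_eq0 a b f : fps_kderiv f = a * Dy f + b * f ->
  (forall n, (fcoef f n)`_0 = 0) -> f = 0.
Proof.
move=> fE f0; suff fm m n : (fcoef f n)`_m = 0.
  by apply: fpsP => n; apply/polyP => m; rewrite fm /= if_same coef0.
elim/ltn_ind: m n => -[|m] IH n //.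
have := congr1 (fun h : fps {poly rat} => (fcoef h n)`_m) fE.
rewrite [fcoef (fps_kderiv f) n]/= coef_deriv fcoefD coefD !fcoefM !coef_sum big1 => [|i _]; last first.
  rewrite coefM big1 // => j _; rewrite /= coefMn IH ?mul0rn ?mulr0 //.
  by rewrite ltnS leq_subr.
rewrite big1 => [|i _]; last first.
  by rewrite coefM big1 // => j _; rewrite IH ?mulr0 // ltnS leq_subr.
by move/eqP; rewrite addr0 mulrn_eq0 => /eqP.
Qed.

End FpsCalculus.

Section Genus01.
Local Notation Dy := (@fps_deriv {poly rat}).
Local Notation K := kappa.
Local Notation Y := (fpsX {poly rat}).

Definition free_energy g : fps {poly rat} := Fps (chi_tilde g).

Lemma free_energy_cut g :
  fps_kderiv (free_energy g) + fps_kderiv (free_energy g) =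
  (if g is g'.+1 then Dy (Dy (free_energy g')) else 0) +
  \sum_(a < g.+1) Dy (free_energy a) * Dy (free_energy (g - a)).
Proof.
apply: fpsP => n; rewrite fcoefD [LHS]/= -mulr2n chi_tilde_edge_cut fcoefD; congr (_ + _).
  case: g => [|g] /=; first by rewrite if_same mul0rn.
  by rewrite -mulrnA.
have -> : fcoef (\sum_(a < g.+1) Dy (free_energy a) * Dy (free_energy (g - a))) n =
  \sum_(a < g.+1) fcoef (Dy (free_energy a) * Dy (free_energy (g - a))) n.
  elim/big_rec2: _ => [|a x y _ <-]; first by rewrite /= if_same.
  by [].
under [RHS]eq_bigr do rewrite fcoefM.
(* the terms n1 = 0 and n1 = n + 2 have no leg to glue *)
rewrite exchange_big /= big_ord_recl mul0n mulr0n add0r big_ord_recr /=.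
rewrite subnn muln0 mulr0n addr0; apply: eq_bigr => i _.
rewrite -sumrMnl; apply: eq_bigr => a _.
have li := ltn_ord i.
rewrite /bump /= add1n subSS subSn; last by rewrite -ltnS.
by rewrite mulrnAl mulrnAr -mulrnA mulnC.
Qed.

(** Burgers' equation for u = F_0'. *)
Lemma deriv_free_energy0 : let u := Dy (free_energy 0) in fps_kderiv u = u * Dy u.
Proof.
move=> u; apply: fps_double_inj; rewrite fps_kderiv_deriv -fps_derivD free_energy_cut.
by rewrite big_ord1 add0r fps_derivM -/u; ring.
Qed.

(** Its linearization, with a source term, for r = F_1'. *)
Lemma deriv_free_energy1 : let u := Dy (free_energy 0) in let r := Dy (free_energy 1) in
  fps_kderiv r = ratC (1 / 2%:R) * Dy (Dy u) + (u * Dy r + Dy u * r).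
Proof.
move=> u r; apply: fps_double_inj; rewrite fps_kderiv_deriv -fps_derivD free_energy_cut.
rewrite big_ord_recl big_ord1 /= -/u -/r fps_derivD fps_derivD !fps_derivM -/u -/r.
have h2 : ratC (1 / 2%:R) + ratC (1 / 2%:R) = 1.
  by apply: fpsP => -[|n] /=; rewrite -?polyCD ?addr0 // (_ : _ + _ = 1).
rewrite -[X in X + _ = _]mul1r -h2; ring.
Qed.

Let u := Dy (free_energy 0).
Let r := Dy (free_energy 1).

(** The terms n < 3, left out in the definition of chi, vanish. *)
Lemma chiE : chi = Y + K * u.
Proof.
apply: fpsP => n; rewrite !fcoefD fcoefCM; congr (_ + _) => /=.
case: ifP => [_|/negbT]; first by rewrite mulrnAr.
by rewrite -leqNgt => n3; rewrite chi_tilde0_small ?mul0rn ?mulr0.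
Qed.

Lemma psiE : psi = K * r.
Proof. by apply: fpsP => n; rewrite fcoefCM /= mulrnAr. Qed.

Lemma coef0_kappaM (f : fps {poly rat}) n : (fcoef (K * f) n)`_0 = 0.
Proof. by rewrite fcoefCM coefXM. Qed.

Lemma coef0_onepYM (f : fps {poly rat}) n :
  (fcoef ((1 + Y) * f) n)`_0 = (fcoef f n)`_0 + (if n is m.+1 then (fcoef f m)`_0 else 0).
Proof.
by rewrite mulrDl mul1r fcoefD coefD fcoefXM; case: n => [|n] //; rewrite coef0.
Qed.

Lemma coef0_u n : (fcoef u n)`_0 = stable_weight 0 n.+1 / (n`!)%:R.
Proof.
rewrite /= coefMn chi_tilde_init factS -mulr_natr natrM; field.
by rewrite nat1r !pnatr_eq0 -lt0n fact_gt0.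
Qed.

Lemma coef0_r n : (fcoef r n)`_0 = stable_weight 1 n.+1 / (n`!)%:R.
Proof.
rewrite /= coefMn chi_tilde_init factS -mulr_natr natrM; field.
by rewrite nat1r !pnatr_eq0 -lt0n fact_gt0.
Qed.

Lemma coef0_u_small n : (n < 2)%N -> (fcoef u n)`_0 = 0.
Proof. by rewrite coef0_u /stable_weight; case: n => [|[|n]] //= _; rewrite mul0r. Qed.

Lemma bernoulli0 : bernoulli 0 = 1.
Proof. by have := bernoulliE 0; rewrite big_ord1 mul1r. Qed.

Lemma bernoulli2 : bernoulli 2 = 1 / 6%:R.
Proof.
have := bernoulliE 1; have := bernoulliE 2.
rewrite !big_ord_recr !big_ord0 /= bernoulli0 !bin0 !bin1.
have -> : 'C(3, 2) = 3%N by [].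
by lra.
Qed.

Lemma coef0_u_closed n : (fcoef u n.+2)`_0 = (-1) ^+ n / (n.+2 * n.+1)%:R.
Proof.
rewrite coef0_u /stable_weight /chi_M muln0 add0n /= fact0 bernoulli0.
rewrite (_ : n.+3 - 3 = n)%N; last by lia.
rewrite !factS !natrM !exprS; field.
by rewrite nat1r -natrD !pnatr_eq0 -!lt0n fact_gt0.
Qed.

Lemma coef0_r_closed n : (fcoef r n)`_0 = - ((-1) ^+ n / 12%:R).
Proof.
rewrite coef0_r /stable_weight /chi_M muln1 /= bernoulli2.
rewrite (_ : 2 + n.+1 - 3 = n)%N; last by lia.
rewrite exprS (_ : 2`! = 2%N) //; field.
by rewrite !pnatr_eq0 -lt0n fact_gt0.
Qed.

(** * Solving the equations *)

(** Its vanishing is the relation between chi and y in genus 0: since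
    kappa * tree_defect = (1 + y - kappa chi) chi' - (1 + chi), it says that
    (1 + y - kappa chi) chi' = 1 + chi. *)
Let tree_defect := (1 + Y - K * chi) * Dy u - u - chi.

(** The difference of the two sides of the theorem, divided by kappa. *)
Let loop_defect := (1 + Y - K * chi) * r - ratC (1 / 2%:R) * K * Dy chi + ratC (1 / 12%:R).

Lemma deriv_kappa : Dy K = 0. Proof. exact: fps_derivC. Qed.
Lemma kderiv_kappa : fps_kderiv K = 1. Proof. by rewrite fps_kderivC derivX. Qed.
Lemma kderiv1 : fps_kderiv 1 = 0.
Proof. by rewrite [LHS]fps_kderivC -polyC1 derivC. Qed.
Lemma fps_deriv1 : Dy 1 = 0. Proof. exact: fps_derivC. Qed.
Lemma kderiv_ratC c : fps_kderiv (ratC c) = 0.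
Proof. by rewrite [LHS]fps_kderivC derivC. Qed.
Lemma deriv_ratC c : Dy (ratC c) = 0. Proof. exact: fps_derivC. Qed.

Let derivE := (fps_kderivD, fps_kderivN, fps_kderivM, kderiv_kappa, kderiv1,
              kderiv_ratC, fps_kderivX,
              fps_derivD, fps_derivN, fps_derivM, deriv_kappa, fps_deriv1, deriv_ratC, fps_derivX).

(** u and chi are constant along the flow of d/dkappa - u d/dy, and u' grows
    by its own square. *)
Lemma tree_defect_flow : fps_kderiv tree_defect = u * Dy tree_defect + Dy u * tree_defect.
Proof.
have du : fps_kderiv u = u * Dy u := deriv_free_energy0.
by rewrite /tree_defect chiE; rewrite !(derivE, fps_kderiv_deriv, du); ring.
Qed.

Lemma tree_defect0 : tree_defect = 0.
Proof.
apply: fps_flow_eq0 tree_defect_flow _ => n.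
(* the part divisible by kappa is split off *)
have -> : tree_defect = (1 + Y) * Dy u - u - Y - K * (chi * Dy u + u)
  by rewrite /tree_defect {2}chiE; ring.
rewrite !fcoefD !fcoefN !coefD !coefN coef0_kappaM coef0_onepYM subr0.
have Du m : (fcoef (Dy u) m)`_0 = (fcoef u m.+1)`_0 * m.+1%:R.
  by rewrite /= coefMn mulr_natr.
rewrite !Du; case: n => [|[|n]].
- by rewrite !coef0_u_small //= coef0 !(mul0r, subr0, addr0).
- rewrite Du coef0_u_closed !coef0_u_small //= coef1 expr0 muln1 !mul0r addr0 subr0.
  by rewrite divfK ?subrr // pnatr_eq0.
rewrite Du !coef0_u_closed /= coef0 subr0 exprS; field.
by rewrite nat1r -!natrD !pnatr_eq0.
Qed.

Lemma loop_defect_flow : fps_kderiv loop_defect = u * Dy loop_defect.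
Proof.
have du : fps_kderiv u = u * Dy u := deriv_free_energy0.
have dr : fps_kderiv r = ratC (1 / 2%:R) * Dy (Dy u) + (u * Dy r + Dy u * r) := deriv_free_energy1.
(* the second derivative of u brought in by r is found in the derivative of
   the genus 0 relation *)
have : fps_kderiv loop_defect - u * Dy loop_defect =
       r * tree_defect + ratC (1 / 2%:R) * Dy tree_defect.
  by rewrite /loop_defect /tree_defect chiE; rewrite !(derivE, fps_kderiv_deriv, du, dr); ring.
rewrite tree_defect0 mulr0 add0r (_ : Dy 0 = 0) ?mulr0; last exact: fps_derivC.
by move/eqP; rewrite subr_eq0 => /eqP.
Qed.

Lemma loop_defect0 : loop_defect = 0.
Proof.
apply: (@fps_flow_eq0 u 0) => [|n]; first by rewrite mul0r addr0 loop_defect_flow.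
have -> : loop_defect = (1 + Y) * r + ratC (1 / 12%:R) - K * (chi * r + ratC (1 / 2%:R) * Dy chi).
  by rewrite /loop_defect; ring.
rewrite !fcoefD !fcoefN !coefD !coefN coef0_kappaM coef0_onepYM subr0.
case: n => [|n]; rewrite !coef0_r_closed /= ?coefC ?coef0 /=.
  by rewrite expr0; ring.
by rewrite exprS; ring.
Qed.

End Genus01.

Theorem theorem3p9 :
  (1 + fpsX _ - kappa * chi) * psi =
  ratC (1 / 2%:R) * kappa ^+ 2 * fps_deriv chi - ratC (1 / 12%:R) * kappa.
Proof.
apply/eqP; rewrite -subr_eq0 psiE.
have <- : kappa * 0 = 0 :> fps {poly rat} by rewrite mulr0.
by rewrite -loop_defect0; apply/eqP; ring.
Qed.
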